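(* (a) Let $h_*>0$. Suppose that $h$ is a solution of $$\partial_\theta\Big(\frac{h^2}{2}\Big)+\partial_\theta\big(h^3(\partial_\theta h+\partial_\theta^3h)\big)=0,\qquad h(\theta+2\pi)=h(\theta).$$ For any $L>0$ there exists $\varepsilon=\varepsilon(L)>0$ such that if $\frac1L\le h_*\le L$ and $h$ satisfies $\|h-h_*\|_{L^\infty(\mathbb{T})}\le\varepsilon$ and $\int_{\mathbb{T}}h(\theta)\,d\theta=2\pi h_*$, then $h=h_*$. (b) There exists a two-parameter family of positive solutions $h\in H^4(\mathbb{T})$ of $$\partial_\theta\big(h^3(\partial_\theta h+\partial_\theta^3h)\big)=0,\qquad h(\theta+2\pi)=h(\theta),$$ with $\int_{\mathbb{T}}h(\theta)\,d\theta=2\pi h_*$, that is given by $h(\theta)=c_1+c_2\sin(\theta-\theta_0)$, where $|c_2|<c_1$, for $c_1>0$, $c_2\in\mathbb{R}$ and $\theta_0\in\mathbb{R}$. (c) Let $h_*>0$. Suppose that $h$ is a solution of one of the two problems $$-c\,\partial_\theta h+\partial_\theta\Big(\frac{h^2}{2}\Big)+\partial_\theta\big(h^3(\partial_\theta h+\partial_\theta^3h)\big)=0,\qquad h(\theta+2\pi)=h(\theta),$$ $$-c\,\partial_\theta h+\partial_\theta\big(h^3(\partial_\theta h+\partial_\theta^3h)\big)=0,\qquad h(\theta+2\pi)=h(\theta).$$ For any $L>0$ there exists $\varepsilon=\varepsilon(L)>0$ such that if $c\in[-L,L]$, $\frac1L\le h_*\le L$ and $h$ satisfies $\|h-h_*\|_{L^\infty(\mathbb{T})}\le\varepsilon$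 and $\int_{\mathbb{T}}h(\theta)\,d\theta=2\pi h_*$, then $h=h_*$.
   Context: $\mathbb{T}=\mathbb{R}/2\pi\mathbb{Z}$, and $H^4(\mathbb{T})$ is the Sobolev space of real $2\pi$-periodic functions. Here $c\in\mathbb{R}$ is a constant (the velocity of a travelling wave), $h_*>0$ is a constant, and, throughout, only positive real-valued functions $h>0$ are considered.
   Formalization: In (c), the second problem is taken only for c ≠ 0: for c = 0 it is the equation of (b), and h = h_* + δ sin θ with small δ > 0 is a nonconstant positive solution with mean h_* arbitrarily close to h_*, so the claim as printed fails there. *)

(* Defs.v *)
From HB Require Import structures.
From mathcomp Require Import all_boot all_order all_algebra.
From mathcomp Require Import all_classical all_reals all_analysis.

Set Implicit Arguments.
Unset Strict Implicit.
Unset Printing Implicit Defensive.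

Import Order.TTheory GRing.Theory Num.Theory.
Import numFieldNormedType.Exports.

Local Open Scope classical_set_scope.
Local Open Scope ring_scope.

(* A function on the torus T = R / 2 pi Z is a 2 pi-periodic function R -> R;
   it is integrated against muT, the Lebesgue measure of one period. *)

Lemma lebesgue_period_lty (R : realType) :
  (@lebesgue_measure R `[0%R, (2 * pi)%R]%classic < +oo)%E.
Proof. by rewrite lebesgue_measure_itv; case: ifP => _ //; rewrite ltry. Qed.

Definition muT (R : realType) :
    {finite_measure set (measurableTypeR R) -> \bar R} :=
  @mfrestr _ (measurableTypeR R) R _ (@lebesgue_measure R)
    (measurable_itv `[0, 2 * pi]) (lebesgue_period_lty R).

Definition test_function (R : realType) (phi : R -> R) : Prop :=
  periodic phi (2 * pi) /\ forall (n : nat) x, derivable (derive1n n phi) x 1.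

(* g is the n-th weak derivative of f on T (determined up to a null set). *)
Definition weak_derivn (R : realType) (n : nat) (f g : R -> R) : Prop :=
  [/\ periodic f (2 * pi) /\ f \in Lfun (muT R) 1%E,
      periodic g (2 * pi) /\ g \in Lfun (muT R) 1%E &
      forall phi : R -> R, test_function phi ->
        \int[muT R]_x (f x * derive1n n phi x) =
        (- 1) ^+ n * \int[muT R]_x (g x * phi x)].

(* H^k(T), as functions rather than classes modulo null sets; for k >= 1 each
   class is represented by its continuous member (Sobolev embedding), so that
   pointwise statements about its elements make sense. *)
Definition HT (R : realType) (k : nat) (h : R -> R) : Prop :=
  continuous h /\
  forall n : nat, (n <= k)%N ->
    exists2 g : R -> R, weak_derivn n h g & g \in Lfun (muT R) 2%:E.

(* d = (h ^ 3 (h' + h'''))' *)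
Definition capillary_term (R : realType) (h d : R -> R) : Prop :=
  exists h1 h3 : R -> R,
    [/\ weak_derivn 1 h h1, weak_derivn 3 h h3 &
        weak_derivn 1 (fun x => h x ^+ 3 * (h1 x + h3 x)) d].

(* (h ^ 2 / 2)' + (h ^ 3 (h' + h'''))' = 0 *)
Definition gravity_steady_eq (R : realType) (h : R -> R) : Prop :=
  exists k d : R -> R,
    [/\ weak_derivn 1 (fun x => h x ^+ 2 / 2) k, capillary_term h d &
        {ae muT R, forall x, k x + d x = 0}].

(* (h ^ 3 (h' + h'''))' = 0 *)
Definition capillary_steady_eq (R : realType) (h : R -> R) : Prop :=
  exists2 d : R -> R, capillary_term h d & {ae muT R, forall x, d x = 0}.

(* - c h' + (h ^ 2 / 2)' + (h ^ 3 (h' + h'''))' = 0 *)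
Definition gravity_wave_eq (R : realType) (c : R) (h : R -> R) : Prop :=
  exists h1 k d : R -> R,
    [/\ weak_derivn 1 h h1, weak_derivn 1 (fun x => h x ^+ 2 / 2) k,
        capillary_term h d &
        {ae muT R, forall x, - c * h1 x + k x + d x = 0}].

(* - c h' + (h ^ 3 (h' + h'''))' = 0 *)
Definition capillary_wave_eq (R : realType) (c : R) (h : R -> R) : Prop :=
  exists h1 d : R -> R,
    [/\ weak_derivn 1 h h1, capillary_term h d &
        {ae muT R, forall x, - c * h1 x + d x = 0}].

Definition positive_solution (R : realType) (eqn : (R -> R) -> Prop)
    (h : R -> R) : Prop :=
  [/\ HT 4 h, (forall x, 0 < h x) & eqn h].

Definition normT_oo (R : realType) (f : R -> R) : \bar R :=
  Lnorm (muT R) +oo%E (EFin \o f).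

(* Main.v *)
(* For (a) and (c) no smallness is needed. Integrating once, h^3 (h' + h''') =
   A + c h - k h^2 / 2 almost everywhere, with k = 1 if gravity is present and
   k = 0 otherwise; dividing by h^3 shows that h is C^3 and satisfies
   h' + h''' = G(h) with G continuous. Since G(h) h' is the derivative of a
   periodic function, multiplying by h' gives that h'^2 and h''^2 have the same
   integral over a period. As h' has mean zero this is the equality case of
   Wirtinger's inequality, so h' is a multiple of a translate of the sine. Then
   G(h) = h' + h''' = 0, that is A + c h - k h^2 / 2 = 0, and unless c = k = 0
   this leaves at most two values for the continuous function h. *)
Require Import Defs.
From HB Require Import structures.
From mathcomp Require Import all_boot all_order all_algebra.
From mathcomp Require Import all_classical all_reals all_analysis.
From mathcomp Require Import measurable_realfun ring lra.

Set Implicit Arguments.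
Unset Strict Implicit.
Unset Printing Implicit Defensive.

Import Order.TTheory GRing.Theory Num.Theory.
Import numFieldNormedType.Exports.

Local Open Scope classical_set_scope.
Local Open Scope ring_scope.

(** The equality case of Wirtinger's inequality is reached without Fourier series, by completing a
    square with a cotangent on each half of a period. The cotangent is singular at the two ends of a
    half period, so the function must vanish there. A periodic function of mean zero need not have
    two zeros at distance [pi], but it takes some value [m] at two points at distance [pi], and
    subtracting [m] costs exactly [2 * pi * m ^+ 2] over a period, which the inequality then forces
    to be zero. Mean zero and the energy identity both enter as periodicity of a primitive, so this
    part contains no integrals. The other obstacle is that the equation holds only weakly, with a
    flux known merely to be integrable. The first integration is therefore du Bois-Reymond's lemma
    in [L^1] on the circle. Its test functions have to be smooth and periodic; powers of a shifted
    cosine concentrate at a point and take the place of bump functions. *)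

(** * Differentiation rules on the real line *)

Section RealDerivatives.
Context {R : realType}.
Implicit Types (f g : R -> R) (x a b : R).

(* The library rules speak of [f + g], [f * g], [f \o g]; here the functions
   are written pointwise, so that the rules apply to lambda terms. *)
Lemma is_derive_add f g x a b : is_derive x 1 f a -> is_derive x 1 g b ->
  is_derive x 1 (fun y => f y + g y) (a + b).
Proof. by move=> ? ?; exact: is_deriveD. Qed.

Lemma is_derive_sub f g x a b : is_derive x 1 f a -> is_derive x 1 g b ->
  is_derive x 1 (fun y => f y - g y) (a - b).
Proof. by move=> ? ?; exact: is_deriveB. Qed.

Lemma is_derive_mul f g x a b : is_derive x 1 f a -> is_derive x 1 g b ->
  is_derive x 1 (fun y => f y * g y) (a * g x + f x * b).
Proof.
move=> ? ?; refine (is_derive_eq (@is_deriveM _ _ f g x 1 a b _ _) _).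
by rewrite /GRing.scale/= addrC [in LHS](mulrC (g x)).
Qed.

Lemma is_derive_scale (c : R) f x a : is_derive x 1 f a ->
  is_derive x 1 (fun y => c * f y) (c * a).
Proof. by move=> ?; exact: is_deriveZ. Qed.

Lemma is_derive_pow n f x a : is_derive x 1 f a ->
  is_derive x 1 (fun y => f y ^+ n.+1) (n.+1%:R * f x ^+ n * a).
Proof.
move=> df; elim: n => [|n ih]; first by rewrite expr0 !mul1r.
have -> : (fun y => f y ^+ n.+2) = (fun y => f y * f y ^+ n.+1).
  by apply/funext => y; rewrite exprS.
refine (is_derive_eq (is_derive_mul df ih) _).
by rewrite -[n.+2%:R]natr1 exprS; ring.
Qed.

Lemma is_derive_comp f g x a b : is_derive (g x) 1 f a -> is_derive x 1 g b ->
  is_derive x 1 (fun y => f (g y)) (a * b).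
Proof.
move=> df dg; refine (is_derive_eq (@is_derive1_comp _ f g x a b _ _) _).
by [].
Qed.

Lemma is_derive_inv f x a : f x != 0 -> is_derive x 1 f a ->
  is_derive x 1 (fun y => (f y)^-1) (- a / f x ^+ 2).
Proof.
move=> fx0 df; refine (is_derive_eq (is_deriveV fx0 df) _).
by rewrite /GRing.scale/= !mulNr mulrC.
Qed.

Lemma is_derive_shiftl f x a b : is_derive (x + b) 1 f a ->
  is_derive x 1 (fun y => f (y + b)) a.
Proof.
move=> df; rewrite -[a]mulr1; apply: is_derive_comp => //.
refine (is_derive_eq (is_derive_add (is_derive_id x 1) (is_derive_cst b x 1)) _).
by rewrite addr0.
Qed.

Lemma is_derive_continuous f x a : is_derive x 1 f a -> {for x, continuous f}.
Proof.
by move=> [df _]; exact/differentiable_continuous/derivable1_diffP.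
Qed.

Lemma is_derive_unique f x a b :
  is_derive x 1 f a -> is_derive x 1 f b -> a = b.
Proof. by move=> [_ <-] [_ <-]. Qed.

Lemma is_derive_near_eq f g x a : (\forall y \near x, f y = g y) ->
  is_derive x 1 f a -> is_derive x 1 g a.
Proof.
by move=> fg df; apply: near_eq_is_derive df.
Qed.

Lemma continuous_within_subset f (A : set R) :
  continuous f -> {within A, continuous f}.
Proof. by move=> cf; apply: continuous_subspaceT. Qed.

Lemma monotone_of_deriv_ge0 f (df : R -> R) a b : a < b ->
  (forall x, a < x < b -> is_derive x 1 f (df x)) ->
  {within `[a, b], continuous f} ->
  (forall x, a < x < b -> 0 <= df x) ->
  forall x y, a <= x -> x <= y -> y <= b -> f x <= f y.
Proof.
move=> ab fdf cf df0 x y ax xy yb.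
apply: (@ger0_derive1_le_cc _ f a b) => //; rewrite ?in_itv/= ?ax ?yb ?andbT.
- by move=> z; rewrite in_itv/= => /fdf [].
- move=> z; rewrite in_itv/= => zab; rewrite derive1E.
  by case: (fdf z zab) => _ ->; exact: df0.
- exact: le_trans xy yb.
- exact: le_trans ax xy.
Qed.

Lemma deriv0_cst f : (forall x, is_derive x 1 f 0) -> forall x y, f x = f y.
Proof. by move=> df x y; exact: is_derive_0_is_cst. Qed.

(* At [b] the quotient has the junk value [0], which here is also its limit. *)
Lemma sqr_div_simple_zero_cvg (w s : R -> R) b l sg :
  is_derive b 1 w l -> is_derive b 1 s sg -> sg != 0 -> w b = 0 -> s b = 0 ->
  {for b, continuous (fun x => w x ^+ 2 / s x)}.
Proof.
move=> dw ds sg0 wb sb.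
move/is_derive1_caratheodory: dw => [gw [wE cgw _]].
move/is_derive1_caratheodory: ds => [gs [sE cgs gsb]].
(* The Carathéodory slopes factor [x - b] out of [w] and [s]; one factor survives upstairs, and
   [gs b = sg] is nonzero. *)
have -> : (fun x => w x ^+ 2 / s x) = (fun x => gw x * gw x * (x - b) / gs x).
  apply/funext => x.
  move: (wE x) (sE x); rewrite wb sb !subr0 => -> ->.
  have [->|xb] := eqVneq x b; first by rewrite subrr !(mulr0, mul0r, expr0n)/=.
  have xb0 : x - b != 0 by rewrite subr_eq0.
  by rewrite invfM; set p := (gs x)^-1; field.
apply: continuousM; last by apply: continuousV => //; rewrite gsb.

apply: continuousM; first exact: continuousM.
by apply: continuousB; [exact: cvg_id|exact: cvg_cst].
Qed.

End RealDerivatives.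

(** * Wirtinger's inequality and its equality case *)

Section Wirtinger.
Context {R : realType}.
Implicit Types (w Q : R -> R) (a x : R).

(* [Q] is nondecreasing on half a period up to the term [w ^ 2 cot (x - a)],
   which vanishes at both ends:
   [w1 ^ 2 - w ^ 2 = (w1 - w cot) ^ 2 + (w ^ 2 cot)']. *)
Lemma wirtinger_half_period w (w1 : R -> R) Q a :
  (forall x, is_derive x 1 w (w1 x)) ->
  (forall x, is_derive x 1 Q (w1 x ^+ 2 - w x ^+ 2)) ->
  w a = 0 -> w (a + pi) = 0 ->
  Q a <= Q (a + pi) /\
  (Q a = Q (a + pi) -> forall x, a < x < a + pi ->
     w1 x * sin (x - a) = w x * cos (x - a)).
Proof.
move=> dw dQ wa wapi.
have pi0 := pi_gt0 R.
have ds (x : R) : is_derive x 1 (fun y => sin (y - a)) (cos (x - a)).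
  exact: (@is_derive_shiftl _ sin x _ (- a) (is_derive_sin _)).
have dc (x : R) : is_derive x 1 (fun y => cos (y - a)) (- sin (x - a)).
  exact: (@is_derive_shiftl _ cos x _ (- a) (is_derive_cos _)).
pose T x := w x ^+ 2 / sin (x - a) * cos (x - a).
pose P x := Q x - T x.
have s0 x : a < x < a + pi -> sin (x - a) != 0.
  by move=> xa; rewrite gt_eqF// sin_gt0_pi//; apply/andP; split; lra.
have dP x : a < x < a + pi ->
    is_derive x 1 P ((w1 x - w x * cos (x - a) / sin (x - a)) ^+ 2).
  move=> /s0 sx.
  refine (is_derive_eq (is_derive_sub (dQ x) (is_derive_mul (is_derive_mul
    (is_derive_pow 1 (dw x)) (is_derive_inv sx (ds x))) (dc x))) _).
  by field.
have cP : {within `[a, a + pi], continuous P}.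
  apply/continuous_within_itvP; first lra.
  have cP x : {for x, continuous T} -> {for x, continuous P}.
    by move=> cT; apply: continuousB => //; exact: is_derive_continuous (dQ x).
  have cT x : w x = 0 -> sin (x - a) = 0 -> cos (x - a) != 0 ->
      {for x, continuous T}.
    move=> wx sx cx.
    apply: continuousM; last exact: is_derive_continuous (dc x).
    exact: (sqr_div_simple_zero_cvg (dw x) (ds x)).
  split.
  - by move=> x; rewrite in_itv/= => /dP /is_derive_continuous.
  - apply/cvg_at_right_filter/cP/cT => //; rewrite subrr ?sin0//.
    by rewrite cos0 oner_eq0.
  - apply/cvg_at_left_filter/cP/cT => //; rewrite addrC addKr ?sinpi//.
    by rewrite cospi oppr_eq0 oner_eq0.
have aapi : a < a + pi by lra.
have mP := monotone_of_deriv_ge0 aapi dP cP (fun x _ => sqr_ge0 _).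
have Pa : P a = Q a by rewrite /P /T wa expr0n/= !mul0r subr0.
have Papi : P (a + pi) = Q (a + pi).
  by rewrite /P /T wapi expr0n/= !mul0r subr0.
split=> [|Qe x /andP[ax xapi]].
  by rewrite -Pa -Papi mP// ltW.
(* A monotone [P] with equal end values is constant, so its derivative, a square, vanishes. *)
have Pc y : a < y < a + pi -> P y = Q a.
  move=> /andP[ay yapi]; apply/eqP; rewrite eq_le -{2}Pa {1}Qe -Papi.
  by rewrite !mP// ltW.
have : is_derive x 1 P 0.
  apply: is_derive_near_eq (is_derive_cst (Q a) x 1).
  have : x \in `]a, a + pi[ by rewrite in_itv/= ax.
  by move=> /near_in_itvoo; apply: filterS => y; rewrite in_itv/= => /Pc ->.
have xapi' : a < x < a + pi by rewrite ax.
move=> /(is_derive_unique (dP x xapi')) /eqP; rewrite sqrf_eq0 subr_eq0 => /eqP ->.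
by rewrite mulfVK// s0.
Qed.

(* Equality case of Wirtinger's inequality: [E x] is the integral up to [x] of
   [v' ^ 2 - v ^ 2], and vanishes over a period. *)
Lemma wirtinger_equality (H v v1 E : R -> R) :
  (forall x, is_derive x 1 H (v x)) -> (forall x, is_derive x 1 v (v1 x)) ->
  (forall x, is_derive x 1 E (v1 x ^+ 2 - v x ^+ 2)) ->
  periodic H (2 * pi) -> periodic v (2 * pi) -> periodic E (2 * pi) ->
  exists a, forall x, a < x < a + pi \/ a + pi < x < a + 2 * pi ->
    v1 x * sin (x - a) = v x * cos (x - a).
Proof.
move=> dH dv dE pH pv pE.
have pi0 := pi_gt0 R.
(* [u] changes sign under translation by [pi], hence has a zero [a]. Then [v - v a] vanishes at [a],
   [a + pi] and [a + 2 * pi], the ends of two half periods. *)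
have [a va] : exists a, v a = v (a + pi).
  pose u x := v x - v (x + pi).
  have cu : continuous u.
    move=> x; apply: continuousB; first exact: is_derive_continuous (dv x).
    exact: is_derive_continuous (is_derive_shiftl (dv _)).
  have [||a _ ua] := @IVT R u 0 pi 0 (ltW pi0); first exact: continuous_within_subset.
    have -> : u pi = - u 0.
      by rewrite /u (_ : pi + pi = 0 + 2 * pi) ?pv ?add0r ?opprB//; ring.
    rewrite ge_min le_max oppr_le0 oppr_ge0.
    by rewrite orbC andbb le_total.
  by exists a; apply/eqP; rewrite -subr_eq0; apply/eqP.
pose m := v a.
pose w x := v x - m.
(* Expanding [(v - m) ^+ 2] adds [2 m v - m ^ 2] to the derivative of [E]. As [E] and [H] are
   periodic, [Q] drops by [2 * pi * m ^+ 2] over a period, whereas the two half periods make it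
   nondecreasing: both inequalities are equalities and [m = 0]. *)
pose Q x := E x + (2 * m * H x - m ^+ 2 * x).
have dw x : is_derive x 1 w (v1 x).
  by refine (is_derive_eq (is_derive_sub (dv x) (is_derive_cst m x 1)) _); rewrite subr0.
have dQ x : is_derive x 1 Q (v1 x ^+ 2 - w x ^+ 2).
  refine (is_derive_eq (is_derive_add (dE x) (is_derive_sub (is_derive_scale
    (2 * m) (dH x)) (is_derive_scale (m ^+ 2) (is_derive_id x 1)))) _).
  by rewrite /w; ring.
have a2 : a + pi + pi = a + 2 * pi by ring.
have w0 : w a = 0 by rewrite /w subrr.
have w1 : w (a + pi) = 0 by rewrite /w /m va subrr.
have w2 : w (a + pi + pi) = 0.
  by rewrite /w a2 pv subrr.
have [le1 eq1] := wirtinger_half_period dw dQ w0 w1.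
have [le2 eq2] := wirtinger_half_period dw dQ w1 w2.
have Q2 : Q (a + pi + pi) = Q a - 2 * pi * m ^+ 2.
  by rewrite /Q a2 pE pH; ring.
have m2 : 0 <= m ^+ 2 := sqr_ge0 m.
have pm : 0 <= pi * m ^+ 2 by rewrite mulr_ge0// ltW.
have pm0 : pi * m ^+ 2 = 0 by lra.
have m0 : m = 0.
  by move/eqP : pm0; rewrite mulf_eq0 gt_eqF//= sqrf_eq0 => /eqP.
have wv x : w x = v x by rewrite /w m0 subr0.
exists a => x [xa|xa].
  by rewrite -wv eq1//; lra.
have E2 : Q (a + pi) = Q (a + pi + pi) by lra.
have xa' : a + pi < x < a + pi + pi by apply/andP; split; lra.
have := eq2 E2 x xa'; rewrite wv.
have -> : x - (a + pi) = x - a - pi by ring.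
rewrite [sin (_ - pi)]sinB [cos (_ - pi)]cosB sinpi cospi => e; lra.
Qed.

End Wirtinger.

Lemma twopi_gt0 {R : realType} : 0 < 2 * pi :> R.
Proof. by rewrite mulr_gt0// pi_gt0. Qed.

Lemma twopi_neq0 {R : realType} : 2 * pi != 0 :> R.
Proof. by rewrite gt_eqF// twopi_gt0. Qed.

(** * Periodic functions *)

Section PeriodicFunctions.
Context {R : realType}.
Implicit Types (f : R -> R) (T x a : R).

Lemma periodic_int f T (k : int) x : periodic f T -> f (x + T *~ k) = f x.
Proof.
move=> pf; case: k => n; first exact: periodicn.
by rewrite NegzE mulrNz -(periodicn pf n.+1 (x - _)) subrK.
Qed.

Lemma periodic_translate f T a x : 0 < T -> periodic f T ->
  exists2 y, a <= y < a + T & f x = f y.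
Proof.
move=> T0 pf; pose k := Num.floor ((x - a) / T).
exists (x + T *~ (- k)); last by rewrite periodic_int.
have /andP[] : k%:~R <= (x - a) / T < (k + 1)%:~R := floor_itv _.
rewrite ler_pdivlMr// ltr_pdivrMr// intrD -mulrzl => k1 k2.
rewrite mulrNz -[T *~ k]mulrzl; apply/andP; split; lra.
Qed.

Lemma periodic_deriv f (f1 : R -> R) T :
  (forall x, is_derive x 1 f (f1 x)) -> periodic f T -> periodic f1 T.
Proof.
move=> df pf x; apply: (is_derive_unique _ (df x)).
have -> : f = fun y => f (y + T) by apply/funext => y; rewrite pf.
exact: is_derive_shiftl (df _).
Qed.

End PeriodicFunctions.

(** * Positive periodic solutions of the third-order equation *)

Section ConstantSolutions.
Context {R : realType}.
Variables (h v v1 : R -> R) (A c k : R).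
Hypothesis h0 : forall x, 0 < h x.
Hypothesis dh : forall x : R, is_derive x 1 h (v x).
Hypothesis dv : forall x : R, is_derive x 1 v (v1 x).
Hypothesis dv1 : forall x : R,
  is_derive x 1 v1 ((A + c * h x - k * (h x ^+ 2 / 2)) / h x ^+ 3 - v x).

(* [Phi] is a primitive of [y |-> (A + c y - k y ^ 2 / 2) / y ^ 3]. *)
Let Phi (y : R) := - (A / 2) * (y * y)^-1 - c * y^-1 - k / 2 * ln y.

(** The derivative of [v * v1] is [v1 ^ 2 - v ^ 2] plus the product of [v] with the nonlinearity in
    [h], and the latter is the derivative of [Phi (h y)]. Periodicity of this function, inherited
    from [h], [v] and [v1], makes it the [E] of [wirtinger_equality]. *)
Lemma is_derive_energy (x : R) :
  is_derive x 1 (fun y => v y * v1 y - Phi (h y)) (v1 x ^+ 2 - v x ^+ 2).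
Proof.
have hx : h x != 0 by rewrite gt_eqF.
have hhx : h x * h x != 0 by rewrite mulf_neq0.
have dln := is_derive_comp (is_derive1_ln (h0 x)) (dh x).
refine (is_derive_eq (is_derive_sub (is_derive_mul (dv x) (dv1 x))
  (is_derive_sub (is_derive_sub
    (is_derive_scale (- (A / 2)) (is_derive_inv
       (f := fun y => h y * h y) hhx (is_derive_mul (dh x) (dh x))))
    (is_derive_scale c (is_derive_inv hx (dh x))))
    (is_derive_scale (k / 2) dln))) _).
by field.
Qed.

(* Wherever [v = C sin], the flux [A + c h - k h ^ 2 / 2] vanishes, a
   nontrivial polynomial equation on the values of [h]. *)
Lemma half_period_constant (a b : R) : (c, k) != (0, 0) ->
  (forall x, b < x < b + pi ->
     sin (x - a) != 0 /\ v1 x * sin (x - a) = v x * cos (x - a)) ->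
  forall x, b <= x <= b + pi -> h x = h b.
Proof.
move=> ck eqn.
have near_b x : b < x < b + pi -> \forall y \near x, b < y < b + pi.
  move=> xb; have : x \in `]b, b + pi[ by rewrite in_itv.
  by move=> /near_in_itvoo; apply: filterS => y; rewrite in_itv.
have flux0 x : b < x < b + pi -> A + c * h x - k * (h x ^+ 2 / 2) = 0.
  move=> xb; have [s0 _] := eqn x xb.
  have hx : h x ^+ 3 != 0 by rewrite expf_neq0// gt_eqF.
  have ds : is_derive x 1 (fun y => sin (y - a)) (cos (x - a)).
    exact: (@is_derive_shiftl _ sin x _ (- a) (is_derive_sin _)).
  have dc : is_derive x 1 (fun y => cos (y - a)) (- sin (x - a)).
    exact: (@is_derive_shiftl _ cos x _ (- a) (is_derive_cos _)).
  (* Differentiating [v1 sin = v cos] cancels the terms [v1 cos] and leaves [(v1' + v) sin = 0],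
     where [v1' + v] is the flux over [h ^ 3]. The relation need not be solved for [v]. *)
  have d1 := is_derive_mul (dv1 x) ds.
  have : is_derive x 1 (fun y => v1 y * sin (y - a))
      (v1 x * cos (x - a) + v x * - sin (x - a)).
    apply: is_derive_near_eq (is_derive_mul (dv x) dc).
    by apply: filterS (near_b x xb) => y /eqn [_ ->].
  move=> /(is_derive_unique d1) e.
  have : (A + c * h x - k * (h x ^+ 2 / 2)) / h x ^+ 3 * sin (x - a) = 0 by lra.
  by move/eqP; rewrite !mulf_eq0 invr_eq0 (negPf s0) (negPf hx) !orbF => /eqP.
have v0 x : b < x < b + pi -> v x = 0.
  move=> xb.
  have : (c - k * h x) * v x = 0.
    have := is_derive_sub (is_derive_add (is_derive_cst A x 1)
      (is_derive_scale c (dh x))) (is_derive_scale k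
        (is_derive_scale (2^-1) (is_derive_mul (dh x) (dh x)))).
    have d0 : is_derive x 1 (fun y => A + c * h y - k * (2^-1 * (h y * h y))) 0.
      apply: is_derive_near_eq (is_derive_cst 0 x 1).
      apply: filterS (near_b x xb) => y /flux0 fy.
      by rewrite -[LHS]/0 -fy expr2; ring.
    by move=> /(is_derive_unique d0) e; lra.
  move/eqP; rewrite mulf_eq0 => /orP[/eqP ckx|/eqP//].
  have [k0|k0] := eqVneq k 0.
    by move: ck ckx; rewrite k0 mul0r subr0 xpair_eqE eqxx andbT => /eqP.
  (* At a point with [c = k h] the quadratic in [h] has a double root: wherever the flux vanishes,
     [(c - k h) ^ 2] equals the discriminant [c ^ 2 + 2 k A], so being zero at [x] it is zero on the
     whole interval. *)
  have sq0 y : b < y < b + pi -> c - k * h y = 0.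
    move=> /flux0 fy; have fx := flux0 x xb.
    apply/eqP; rewrite -sqrf_eq0; apply/eqP.
    have -> : (c - k * h y) ^+ 2 = (c - k * h x) ^+ 2.
      have e z : (c - k * h z) ^+ 2 =
          c ^+ 2 + 2 * k * A - 2 * k * (A + c * h z - k * (h z ^+ 2 / 2)).
        by field.
      by rewrite !e fx fy.
    by rewrite ckx expr0n.
  have d0 : is_derive x 1 (fun y => c - k * h y) 0.
    apply: is_derive_near_eq (is_derive_cst 0 x 1).
    by apply: filterS (near_b x xb) => y /sq0.
  have /(is_derive_unique d0) := is_derive_sub (is_derive_cst c x 1)
    (is_derive_scale k (dh x)).
  by move/eqP; rewrite sub0r eq_sym oppr_eq0 mulf_eq0 (negPf k0) => /eqP.
move=> x /andP[bx xb].
move: bx; rewrite le_eqVlt => /predU1P[->//|bx].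
have [|z] := MVT bx (fun z _ => dh z).
  by apply: continuous_within_subset => z; exact: is_derive_continuous (dh z).
rewrite in_itv/= => /andP[bz zx]; rewrite v0; last by rewrite bz (lt_le_trans zx).
by rewrite mul0r => /eqP; rewrite subr_eq0 => /eqP.
Qed.

Lemma periodic_solution_constant :
  (c, k) != (0, 0) -> periodic h (2 * pi) -> exists C, forall x, h x = C.
Proof.
move=> ck ph.
have pi0 := pi_gt0 R.
have pv := periodic_deriv dh ph.
have pv1 := periodic_deriv dv pv.
have pE : periodic (fun y => v y * v1 y - Phi (h y)) (2 * pi).
  by move=> x; rewrite pv pv1 ph.
have [a eqn] := wirtinger_equality dh dv is_derive_energy ph pv pE.
exists (h a) => x.
have h1 : forall x, a <= x <= a + pi -> h x = h a.
  apply: (half_period_constant (a := a)) => // y ya.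
  split; last by apply: eqn; left.
  by rewrite gt_eqF// sin_gt0_pi//; apply/andP; split; lra.
have h2 : forall x, a + pi <= x <= a + pi + pi -> h x = h (a + pi).
  apply: (half_period_constant (a := a)) => // y ya.
  split; last by apply: eqn; right; apply/andP; split; lra.
  have -> : y - a = y - a - pi + pi by ring.
  rewrite sinDpi oppr_eq0 gt_eqF// sin_gt0_pi//; apply/andP; split; lra.
have T0 : 0 < 2 * pi :> R by rewrite mulr_gt0.
have [y /andP[ay ya] ->] := periodic_translate a x T0 ph.
(* The two closed half periods share the point [a + pi], which identifies their constants. *)
have [ya1|ya1] := lerP y (a + pi); first by rewrite h1// ay.
by rewrite h2 ?h1//; apply/andP; split; lra.
Qed.

End ConstantSolutions.

Local Notation measurableR f :=
  (@measurable_fun _ _ (measurableTypeR _) (measurableTypeR _) setT f).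

(** * Integration over one period *)

Section TorusIntegral.
Context {R : realType}.
Notation mu := (@lebesgue_measure R).
Notation TT := `[0%R, (2 * pi)%R]%classic.
Implicit Types (f g F phi : R -> R) (x a b : R).

Lemma muT_setC : muT R (~` TT) = 0%E.
Proof. by rewrite /muT/= /mfrestr /mrestr setICl measure0. Qed.

Lemma integral_muT f : measurableR f ->
  (\int[muT R]_x (f x)%:E = \int[mu]_(x in TT) (f x)%:E)%E.
Proof.
move=> /measurable_EFinP mf.
have mT : measurable (TT : set (measurableTypeR R)) by exact: measurable_itv.
transitivity (\int[muT R]_(x in TT) (f x)%:E)%E.
  rewrite [RHS]integral_mkcond; apply: ae_eq_integral => //.
    by apply/(measurable_restrictT _ mT); apply: measurable_funS mf.
  exists (~` TT); split; [exact: measurableC|exact: muT_setC|].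
  move=> x /= xg xT; apply: xg => _; rewrite patchE ifT//.
  exact: mem_set.
apply: eq_measure_integral => A mA AT.
by rewrite /= /mfrestr /mrestr setIidl.
Qed.

Lemma integrable_muT f : (muT R).-integrable setT (EFin \o f) ->
  mu.-integrable TT (EFin \o f).
Proof.
move=> /integrableP[mf foo]; apply/integrableP; split.
  by apply: measurable_funS mf.
have := @integral_muT (fun x => `|f x|) => /= <-//.
by apply: measurableT_comp => //; exact/measurable_EFinP.
Qed.

Lemma Rintegral_muT f : measurableR f ->
  \int[muT R]_x f x = \int[mu]_(x in TT) f x.
Proof. by move=> mf; congr fine; exact: integral_muT. Qed.

Lemma Lfun_measurable p f : f \in Lfun (muT R) p -> measurableR f.
Proof. by move=> /sub_Lfun_mfun /set_mem. Qed.

Lemma Lfun1_integrable_period f : f \in Lfun (muT R) 1%E ->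
  mu.-integrable TT (EFin \o f).
Proof. by move=> /Lfun1_integrable /integrable_muT. Qed.

Lemma continuous_integrable_itv f a b : continuous f ->
  mu.-integrable `[a, b] (EFin \o f).
Proof.
move=> cf; apply: continuous_compact_integrable; first exact: segment_compact.
exact: continuous_within_subset.
Qed.

Lemma integrable_mul_continuous f g :
  mu.-integrable TT (EFin \o f) -> continuous g ->
  mu.-integrable TT (EFin \o (fun x => f x * g x)).
Proof.
move=> intf cg.
apply: (integrableMl _ intf) => //.
  by apply: measurable_funS (continuous_measurable_fun cg).
have /compact_bounded[M [_ gM]] := continuous_compact
  (continuous_within_subset (A := TT) cg) (segment_compact (a := 0) (b := 2 * pi)).
by exists M; split; rewrite ?num_real// => y My x xT; apply: gM => //; exists x.
Qed.

Lemma integral_antiderivative_itv f F a b : a <= b -> continuous f ->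
  (forall x, is_derive x 1 F (f x)) ->
  \int[mu]_(x in `[a, b]) f x = F b - F a.
Proof.
rewrite le_eqVlt => /predU1P[->|ab] cf dF.
  by rewrite set_itv1 Rintegral_set1 subrr.
rewrite /Rintegral (@continuous_FTC2 _ f F)//.
- exact: continuous_within_subset.
- split.
  + by move=> x _; case: (dF x).
  + by apply: cvg_at_right_filter; exact: is_derive_continuous (dF _).
  + by apply: cvg_at_left_filter; exact: is_derive_continuous (dF _).
- by move=> x _; rewrite derive1E; case: (dF x).
Qed.

Lemma integral_antiderivative f F : continuous f ->
  (forall x, is_derive x 1 F (f x)) ->
  \int[mu]_(x in TT) f x = F (2 * pi) - F 0.
Proof. by apply: integral_antiderivative_itv; exact: ltW twopi_gt0. Qed.

Lemma integral_by_parts_periodic f phi (f1 phi1 : R -> R) :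
  (forall x, is_derive x 1 f (f1 x)) -> continuous f1 -> periodic f (2 * pi) ->
  (forall x, is_derive x 1 phi (phi1 x)) -> continuous phi1 ->
  periodic phi (2 * pi) ->
  \int[mu]_(x in TT) (f x * phi1 x) = - \int[mu]_(x in TT) (f1 x * phi x).
Proof.
move=> df cf1 pf dphi cphi1 pphi.
have cf x : {for x, continuous f} by exact: is_derive_continuous (df x).
have cphi x : {for x, continuous phi} by exact: is_derive_continuous (dphi x).
have c1 : continuous (fun x => f1 x * phi x).
  by move=> x; apply: continuousM; [exact: cf1|exact: cphi].
have c2 : continuous (fun x => f x * phi1 x).
  by move=> x; apply: continuousM; [exact: cf|exact: cphi1].
have := integral_antiderivative _ (fun x => is_derive_mul (df x) (dphi x)).
rewrite RintegralD//; [|exact: continuous_integrable_itv..].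
rewrite -(add0r (2 * pi)) pf pphi subrr => e; apply/eqP.
rewrite -addr_eq0 addrC; apply/eqP/e => x.
by apply: cvgD; [exact: c1|exact: c2].
Qed.

Lemma antiderivative f : continuous f ->
  exists F : R -> R, forall x, is_derive x 1 F (f x).
Proof.
move=> cf.
have If a b : mu.-integrable `[a, b] (EFin \o f).
  exact: continuous_integrable_itv.
pose G a x := \int[mu]_(t in `[a, x]) f t.
have GB a b x : a <= b -> b <= x -> G a x = G a b + G b x.
  move=> ab bx; apply/eqP; rewrite addrC -subr_eq; apply/eqP.
  rewrite /G Rintegral_itvB ?bnd_simp//.
  rewrite Rintegral_itv_obnd_cbnd//.
  by apply: integrableS (If b x) => //; exact: subset_itv_oc_cc.
(* [F x] is the integral from [0] to [x], with a base point to the left of both. *)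
pose F x := G (- (`|x| + 1)) x - G (- (`|x| + 1)) 0.
have FN N x : `|x| + 1 <= N -> F x = G (- N) x - G (- N) 0.
  move=> xN; have := ler_norm x; have := ler_norm (- x); rewrite normrN => x1 x2.
  have := normr_ge0 x => x0.
  by rewrite (GB (- N) (- (`|x| + 1)) x) ?(GB (- N) (- (`|x| + 1)) 0) /F; lra.
exists F => x.
(* With this margin [FN] applies to every [y] with [|y - x| < 1], so near [x] the function [F] is
   computed from one fixed base point. *)
pose N := `|x| + 2.
have dG : is_derive x 1 (fun y => G (- N) y - G (- N) 0) (f x).
  have [||d1 d2] := @continuous_FTC1_closed R f (- N) x (x + 1) _ (If _ _) _ (cf x).
  - by rewrite ltrDl.
  - by have := ler_norm (- x); rewrite normrN /N => ?; lra.
  rewrite -[f x]subr0; apply: is_derive_sub (is_derive_cst (G (- N) 0) x 1).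
  by split; [exact: d1|rewrite -derive1E].
apply: is_derive_near_eq dG.
near=> y.
apply/esym/FN; rewrite /N.
have yx : `|y - x| < 1 by near: y; exact: cvgr_distC_lt.
have := ler_normD (y - x) x; rewrite subrK; lra.
Unshelve. all: by end_near. Qed.

End TorusIntegral.

(** * Integration by parts for integrable functions *)

Section IntegrationByPartsL1.
Context {R : realType}.
Notation mu := (@lebesgue_measure R).
Notation TT := `[0%R, (2 * pi)%R]%classic.
Implicit Types (f g u : R -> R) (x : R).

Lemma within_continuous_integrable f :
  {within TT, continuous f} -> mu.-integrable TT (EFin \o f).
Proof. exact: continuous_compact_integrable (@segment_compact _ _ _). Qed.

Lemma within_continuousM f g : {within TT, continuous f} -> continuous g ->
  {within TT, continuous (fun x => f x * g x)}.
Proof.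
move=> cf cg x; apply: continuousM; first exact: cf.
exact: continuous_within_subset.
Qed.

Lemma lebesgue_measure_period : fine (mu TT) = 2 * pi.
Proof. by rewrite lebesgue_measure_itv/= lte_fin twopi_gt0 -EFinB/= subr0. Qed.

Lemma integrable_norm f : mu.-integrable TT (EFin \o f) ->
  mu.-integrable TT (EFin \o (fun x => `|f x|)).
Proof. by move=> /integrable_abse. Qed.

Lemma norm_integral_le f g : mu.-integrable TT (EFin \o f) ->
  mu.-integrable TT (EFin \o g) -> (forall x, TT x -> `|f x| <= g x) ->
  `|\int[mu]_(x in TT) f x| <= \int[mu]_(x in TT) g x.
Proof.
move=> intf intg fg; apply: le_trans (le_normr_Rintegral _ _) _ => //.
by apply: le_Rintegral => //; exact: integrable_norm.
Qed.

Lemma continuous_bounded_period f : continuous f ->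
  exists2 M, 0 <= M & forall x, TT x -> `|f x| <= M.
Proof.
move=> cf; have /compact_bounded[M [_ fM]] := continuous_compact
  (continuous_within_subset (A := TT) cf) (segment_compact (a := 0) (b := 2 * pi)).
exists (`|M| + 1); first by rewrite addr_ge0.
by move=> x xT; apply: fM; [rewrite ltr_pwDr// ler_norm|exists x].
Qed.

Variables phi phi1 : R -> R.
Hypothesis dphi : forall x, is_derive x 1 phi (phi1 x).
Hypothesis cphi1 : continuous phi1.

Let cphi : continuous phi.
Proof. by move=> x; exact: is_derive_continuous (dphi x). Qed.

Let G f x := \int[mu]_(t in `[0, x]) f t.
(** The error in integrating [f * phi] by parts with the primitive [G f]. Only the boundary term at
    [2 * pi] occurs, since [G f] vanishes at [0]. *)
Let defect f := \int[mu]_(x in TT) (f x * phi x) +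
  \int[mu]_(x in TT) (G f x * phi1 x) - G f (2 * pi) * phi (2 * pi).

Let defect_continuous g : continuous g -> defect g = 0.
Proof.
move=> cg; have [F dF] := antiderivative cg.
have GE x : 0 <= x -> G g x = F x - F 0.
  by move=> x0; exact: integral_antiderivative_itv.
have dF0 x : is_derive x 1 (fun y => F y - F 0) (g x).
  by rewrite -[g x]subr0; apply: is_derive_sub (is_derive_cst (F 0) x 1).
have cF0 : continuous (fun y => F y - F 0).
  by move=> x; exact: is_derive_continuous (dF0 x).
have c1 : continuous (fun x => g x * phi x).
  by move=> x; apply: cvgM; [exact: cg|exact: cphi].
have c2 : continuous (fun x => (F x - F 0) * phi1 x).
  by move=> x; apply: cvgM; [exact: cF0|exact: cphi1].
rewrite /defect GE ?(ltW twopi_gt0)//.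
rewrite (@eq_Rintegral _ _ _ mu TT (fun x => (F x - F 0) * phi1 x)
   (fun x => G g x * phi1 x)); last first.
  by move=> x /set_mem/=; rewrite in_itv/= => /andP[x0 _]; rewrite GE.
rewrite -RintegralD//; [|exact: continuous_integrable_itv..].
have c12 : continuous (fun x => g x * phi x + (F x - F 0) * phi1 x).
  by move=> x; apply: cvgD; [exact: c1|exact: c2].
rewrite (integral_antiderivative c12 (fun x => is_derive_mul (dF0 x) (dphi x))).
by rewrite subrr mul0r subr0 subrr.
Qed.

Let integrable_sub_itv f x : mu.-integrable TT (EFin \o f) -> x <= 2 * pi ->
  mu.-integrable `[0, x] (EFin \o f).
Proof. by move=> intf xT; apply: integrableS intf => //; exact: subset_itvl. Qed.

Lemma primitive_within_continuous f : mu.-integrable TT (EFin \o f) ->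
  {within TT, continuous (G f)}.
Proof. exact: parameterized_integral_continuous (ltW twopi_gt0). Qed.

Let integrable_primitive f : mu.-integrable TT (EFin \o f) ->
  mu.-integrable TT (EFin \o (fun x => G f x * phi1 x)).
Proof.
move=> intf; apply: within_continuous_integrable; apply: within_continuousM => //.
exact: primitive_within_continuous.
Qed.

Let defectB f g : mu.-integrable TT (EFin \o f) -> mu.-integrable TT (EFin \o g) ->
  defect (fun x => f x - g x) = defect f - defect g.
Proof.
move=> intf intg.
have GB x : TT x -> G (fun x => f x - g x) x = G f x - G g x.
  rewrite /= in_itv/= => /andP[_ xT].
  by rewrite /G RintegralB//; exact: integrable_sub_itv.
rewrite /defect GB; last by rewrite /= in_itv/= lexx (ltW twopi_gt0).
rewrite (@eq_Rintegral _ _ _ mu TT (fun x => f x * phi x - g x * phi x)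
   (fun x => (f x - g x) * phi x)); last first.
  by move=> x _; rewrite mulrBl.
rewrite (@eq_Rintegral _ _ _ mu TT (fun x => G f x * phi1 x - G g x * phi1 x)
   (fun x => G (fun x => f x - g x) x * phi1 x)); last first.
  by move=> x /set_mem xT; rewrite GB// mulrBl.
rewrite !RintegralB//; try exact: integrable_primitive;
  try exact: integrable_mul_continuous.
by ring.
Qed.

Let defect_bounded : exists2 C, 0 <= C &
  forall u, mu.-integrable TT (EFin \o u) ->
    `|defect u| <= C * \int[mu]_(x in TT) `|u x|.
Proof.
have [M M0 phiM] := continuous_bounded_period cphi.
have [M1 M10 phiM1] := continuous_bounded_period cphi1.
(* One summand for each term of [defect]; the last two use that [G u] is bounded on the period by
   the [L^1] norm of [u]. *)
exists (M + M1 * (2 * pi) + M) => [|u intu].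
  by rewrite !addr_ge0// mulr_ge0// ltW ?twopi_gt0.
have intn := integrable_norm intu.
set I := \int[mu]_(x in TT) `|u x|.
have GI x : TT x -> `|G u x| <= I.
  rewrite /= in_itv/= => /andP[x0 xT].
  apply: le_trans (le_normr_Rintegral _ _) _ => //; first exact: integrable_sub_itv.
  rewrite /I -subr_ge0 Rintegral_itvB ?bnd_simp//.
  exact: Rintegral_ge0.
have b1 : `|\int[mu]_(x in TT) (u x * phi x)| <= M * I.
  rewrite /I -RintegralZl//; apply: norm_integral_le => //.
  - exact: integrable_mul_continuous.
  - exact: (@integrableZl _ _ _ mu TT _ M (EFin \o (fun x => `|u x|))).
  - by move=> x xT; rewrite normrM mulrC ler_wpM2r// phiM.
have b2 : `|\int[mu]_(x in TT) (G u x * phi1 x)| <= M1 * (2 * pi) * I.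
  have -> : M1 * (2 * pi) * I = \int[mu]_(x in TT) (M1 * I).
    by rewrite Rintegral_cst// lebesgue_measure_period mulrAC.
  apply: norm_integral_le.
  - exact: integrable_primitive.
  - by apply: continuous_integrable_itv => x; exact: cvg_cst.
  - by move=> x xT; rewrite normrM mulrC ler_pM// ?phiM1// GI.
have b3 : `|G u (2 * pi) * phi (2 * pi)| <= M * I.
  have T2 : TT (2 * pi : R) by rewrite /= in_itv/= lexx (ltW twopi_gt0).
  by rewrite normrM mulrC ler_pM// ?phiM// GI.
apply: le_trans (ler_normB _ _) _; apply: le_trans (lerD (ler_normD _ _) (lexx _)) _.
have -> : (M + M1 * (2 * pi) + M) * I = M * I + M1 * (2 * pi) * I + M * I by ring.
by rewrite !lerD.
Qed.

(* Both sides are continuous in the [L^1] norm of [f], and continuous functions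
   are dense in [L^1]. *)
Lemma integral_by_parts_L1 f : mu.-integrable TT (EFin \o f) ->
  \int[mu]_(x in TT) (f x * phi x) =
  (\int[mu]_(x in TT) f x) * phi (2 * pi) -
  \int[mu]_(x in TT) ((\int[mu]_(t in `[0, x]) f t) * phi1 x).
Proof.
move=> intf; suff : defect f = 0 by rewrite /defect /G => ?; lra.
have [C C0 defC] := defect_bounded.
have mTT : measurable (TT : set (measurableTypeR R)) by exact: measurable_itv.
have TToo : (mu TT < +oo)%E by exact: lebesgue_period_lty.
have [g [cg intg fg]] := approximation_continuous_integrable mTT TToo intf.
apply/eqP; rewrite -normr_le0; apply/ler_addgt0Pr => e e0; rewrite add0r.
(* [C] may be zero, hence the denominator [C + 1]. *)
have e1 : 0 < e / (C + 1) by rewrite divr_gt0// ltr_wpDl.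
move/fine_cvgP : fg => [_ fg].
have [n _ /(_ n (leqnn n))/= fgn] := cvgr_lt _ fg _ e1.
have intfg : mu.-integrable TT (EFin \o (fun x => f x - g n x)).
  exact: (integrableB _ intf (intg n)).
have := defC _ intfg; rewrite defectB// (defect_continuous (cg n)) subr0.
move=> /le_trans; apply; apply: (@le_trans _ _ (C * (e / (C + 1)))).
  by rewrite ler_wpM2l// ltW.
rewrite mulrA ler_pdivrMr ?ltr_wpDl// mulrC ler_pM2l//; lra.
Qed.

End IntegrationByPartsL1.

(** * Test functions on the circle *)

Section TestFunctions.
Context {R : realType}.
Notation mu := (@lebesgue_measure R).
Notation TT := `[0%R, (2 * pi)%R]%classic.
Implicit Types (f g phi psi : R -> R) (x y t d : R).

Lemma test_is_derive phi x : test_function phi -> is_derive x 1 phi ((derive1 phi) x).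
Proof. by move=> [_ /(_ 0 x) dphi]; rewrite derive1E; exact/derivableP. Qed.

Lemma test_continuous phi : test_function phi -> continuous phi.
Proof. by move=> tphi x; exact: is_derive_continuous (test_is_derive x tphi). Qed.

Lemma test_derive1 phi : test_function phi -> test_function (derive1 phi).
Proof.
move=> tphi; split => [|n x].
  exact: periodic_deriv (fun x => test_is_derive x tphi) tphi.1.
by rewrite -derive1Sn; exact: tphi.2.
Qed.

Lemma test_antiderivative f g : (forall x, is_derive x 1 f (g x)) ->
  test_function g -> periodic f (2 * pi) -> test_function f.
Proof.
move=> df tg pf; split=> // -[|n] x; first by case: (df x).
have -> : derive1n n.+1 f = derive1n n g.
  by rewrite derive1Sn; congr derive1n; apply/funext => y; rewrite derive1E; case: (df y).
exact: tg.2.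
Qed.

(** The source of all explicit test functions: the class is closed under differentiation, which
    gives smoothness by induction, and under products, which gives the concentrating powers of
    [fundamental_lemma_pos]. *)
Inductive trig_poly : (R -> R) -> Prop :=
| trig_cst c : trig_poly (fun=> c)
| trig_sin t : trig_poly (fun x => sin (x - t))
| trig_cos t : trig_poly (fun x => cos (x - t))
| trig_add f g : trig_poly f -> trig_poly g -> trig_poly (fun x => f x + g x)
| trig_mul f g : trig_poly f -> trig_poly g -> trig_poly (fun x => f x * g x).

Lemma trig_poly_periodic f : trig_poly f -> periodic f (2 * pi).
Proof.
elim=> [c|t|t|g h _ pg _ ph|g h _ pg _ ph] x //=.
- by rewrite addrAC mulr_natl sinD2pi.
- by rewrite addrAC mulr_natl cosD2pi.
- by rewrite pg ph.
- by rewrite pg ph.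
Qed.

Lemma trig_poly_derive f : trig_poly f ->
  exists2 g, trig_poly g & forall x, is_derive x 1 f (g x).
Proof.
elim=> [c|t|t|g h tg [g1 tg1 dg] th [h1 th1 dh]|g h tg [g1 tg1 dg] th [h1 th1 dh]].
- by exists (fun=> 0); [exact: trig_cst|move=> x; exact: is_derive_cst].
- exists (fun x => cos (x - t)); first exact: trig_cos.
  by move=> x; exact: (@is_derive_shiftl _ sin x _ (- t) (is_derive_sin _)).
- exists (fun x => -1 * sin (x - t)).
    exact: trig_mul (trig_cst _) (trig_sin _).
  move=> x; rewrite mulN1r.
  exact: (@is_derive_shiftl _ cos x _ (- t) (is_derive_cos _)).
- exists (fun x => g1 x + h1 x); first exact: trig_add.
  by move=> x; exact: is_derive_add.
- exists (fun x => g1 x * h x + g x * h1 x).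
    by apply: trig_add; exact: trig_mul.
  by move=> x; exact: is_derive_mul.
Qed.

Lemma trig_poly_test f : trig_poly f -> test_function f.
Proof.
move=> tf; split; first exact: trig_poly_periodic.
move=> n; elim: n f tf => [|n ih] f tf x; have [g tg dg] := trig_poly_derive tf.
  by case: (dg x).
have fg : (derive1 f) = g.
  by apply/funext => y; rewrite derive1E; case: (dg y).
by rewrite derive1Sn fg; exact: ih.
Qed.

Lemma trig_poly_pow f n : trig_poly f -> trig_poly (fun x => f x ^+ n).
Proof.
move=> tf; elim: n => [|n ih]; first exact: trig_cst.
have -> : (fun x => f x ^+ n.+1) = (fun x => f x * f x ^+ n).
  by apply/funext => x; rewrite exprS.
exact: trig_mul.
Qed.

Lemma test_cst (c : R) : test_function (fun=> c).
Proof. exact/trig_poly_test/trig_cst. Qed.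

Lemma periodic_antiderivative f F : continuous f -> periodic f (2 * pi) ->
  \int[mu]_(x in TT) f x = 0 -> (forall x, is_derive x 1 F (f x)) ->
  periodic F (2 * pi).
Proof.
move=> cf pf f0 dF x; apply/eqP; rewrite -subr_eq0; apply/eqP.
have d0 y : is_derive y 1 (fun z => F (z + 2 * pi) - F z) 0.
  rewrite -(subrr (f y)) -{1}(pf y).
  exact: is_derive_sub (is_derive_shiftl (dF _)) (dF y).
by rewrite (deriv0_cst d0 x 0) add0r -(integral_antiderivative cf dF).
Qed.

(** On the circle the mean is the only obstruction to a primitive: over one period a primitive grows
    by the integral. *)
Lemma test_mean0_derive psi : test_function psi ->
  \int[mu]_(x in TT) psi x = 0 ->
  exists2 phi, test_function phi & derive1 phi = psi.
Proof.
move=> tpsi psi0; have cpsi := test_continuous tpsi.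
have [F dF] := antiderivative cpsi.
have pF := periodic_antiderivative cpsi tpsi.1 psi0 dF.
exists F; first exact: test_antiderivative dF tpsi pF.
by apply/funext => y; rewrite derive1E; case: (dF y).
Qed.

Lemma integral_cst_period (c : R) : \int[mu]_(x in TT) c = c * (2 * pi).
Proof. by rewrite Rintegral_cst// lebesgue_measure_period. Qed.

Lemma integrable_cst (c : R) : mu.-integrable TT (EFin \o (fun=> c)).
Proof. by apply: continuous_integrable_itv => x; exact: cvg_cst. Qed.

Lemma integrable_scale f c : mu.-integrable TT (EFin \o f) ->
  mu.-integrable TT (EFin \o (fun x => c * f x)).
Proof. by move=> intf; exact: (@integrableZl _ _ _ mu TT _ c (EFin \o f)). Qed.

Lemma integrable_sub f g : mu.-integrable TT (EFin \o f) ->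
  mu.-integrable TT (EFin \o g) ->
  mu.-integrable TT (EFin \o (fun x => f x - g x)).
Proof. by move=> intf intg; exact: (integrableB _ intf intg). Qed.

Lemma test_sub_mean_derive psi : test_function psi ->
  exists2 phi, test_function phi & derive1 phi =
    (fun x => psi x - (\int[mu]_(y in TT) psi y) / (2 * pi)).
Proof.
move=> tpsi; set Ip := \int[mu]_(y in TT) psi y.
apply: test_mean0_derive; last first.
  rewrite RintegralB//; last exact: integrable_cst.
    by rewrite integral_cst_period divfK ?subrr// twopi_neq0.
  exact: continuous_integrable_itv (test_continuous tpsi).
apply: (test_antiderivative (g := (derive1 psi))) (test_derive1 tpsi) _.
  move=> x; rewrite -[derive1 psi x]subr0.
  by apply: is_derive_sub (test_is_derive x tpsi) (is_derive_cst _ _ _).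
by move=> x; rewrite tpsi.1.
Qed.

(* Subtracting its mean from a test function [psi] leaves the derivative of a
   test function, so testing against derivatives only sees [f] up to its mean. *)
Lemma integral_sub_mean f psi : mu.-integrable TT (EFin \o f) ->
  (forall phi, test_function phi -> \int[mu]_(x in TT) (f x * derive1 phi x) = 0) ->
  test_function psi ->
  \int[mu]_(x in TT) ((f x - (\int[mu]_(y in TT) f y) / (2 * pi)) * psi x) = 0.
Proof.
move=> intf f0 tpsi; have cpsi := test_continuous tpsi.
have ipsi : mu.-integrable TT (EFin \o psi) by exact: continuous_integrable_itv.
have ifpsi := integrable_mul_continuous intf cpsi.
have [phi tphi phiE] := test_sub_mean_derive tpsi.
have := f0 _ tphi; rewrite phiE.
set If := \int[mu]_(y in TT) f y; set Ip := \int[mu]_(y in TT) psi y.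
rewrite (@eq_Rintegral _ _ _ mu TT
  (fun x => f x * psi x - Ip / (2 * pi) * f x)); last first.
  by move=> x _; ring.
rewrite (@eq_Rintegral _ _ _ mu TT (fun x => f x * psi x - If / (2 * pi) * psi x)
   (fun x => (f x - If / (2 * pi)) * psi x)); last first.
  by move=> x _; ring.
rewrite !RintegralB ?RintegralZl//; try exact: integrable_scale.
by rewrite -/If -/Ip => ?; rewrite mulrAC [If * Ip]mulrC mulrAC.
Qed.

End TestFunctions.

(** * The fundamental lemma and du Bois-Reymond's lemma *)

Section FundamentalLemma.
Context {R : realType}.
Notation mu := (@lebesgue_measure R).
Notation TT := `[0%R, (2 * pi)%R]%classic.
Implicit Types (f g H phi psi : R -> R) (x y z t d : R).

Lemma pow_unbounded (r M : R) : 1 < r -> exists n, M < r ^+ n.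
Proof.
move=> r1; have bern n : 1 + n%:R * (r - 1) <= r ^+ n.
  elim: n => [|n ih]; first by rewrite mul0r addr0 expr0.
  rewrite exprS -natr1.
  have n0 : 0 <= n%:R * (r - 1) * (r - 1) by rewrite -mulrA mulr_ge0// -expr2 sqr_ge0.
  have r0 : 0 <= r by rewrite ltW// (lt_trans ltr01).
  apply: le_trans (ler_wpM2l r0 ih).
  rewrite -subr_ge0; apply: le_trans n0 _; rewrite le_eqVlt; apply/orP; left.
  by apply/eqP; ring.
have r0 : 0 < r - 1 by rewrite subr_gt0.
have := archi_boundP (normr_ge0 (M / (r - 1))).
set n := Num.bound _ => nM; exists n; apply: lt_le_trans (bern n).
have : M / (r - 1) < n%:R by exact: le_lt_trans (ler_norm _) nM.
by rewrite ltr_pdivrMr//; lra.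
Qed.

Lemma cos_le_cos x y : 0 <= x -> x <= y -> y <= pi -> cos y <= cos x.
Proof.
move=> x0 xy ypi; rewrite leNgt ltr_cos ?in_itv/= -?leNgt// ?x0 ?ypi ?andbT.
  exact: le_trans xy.
exact: le_trans ypi.
Qed.

Lemma cos_abs x : cos `|x| = cos x.
Proof.
by case: (lerP 0 x) => [/ger0_norm|/ltr0_norm] ->; rewrite ?cosN.
Qed.

Lemma cos_le_cos_far d z : 0 <= d -> d <= z -> z <= 2 * pi - d ->
  cos z <= cos d.
Proof.
move=> d0 dz zd; have [zpi|piz] := lerP z pi; first exact: cos_le_cos.
have -> : cos z = cos (2 * pi - z).
  by rewrite -[RHS]cosN opprB -[RHS]cosD2pi mulr2n; congr cos; ring.
by apply: cos_le_cos; lra.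
Qed.

(* The test functions [q ^ n] with [q x = (1 + cos (x - t)) / (1 + cos d)]
   concentrate at [t]: [0 <= q <= 1] at distance more than [d] of [t], and
   [q >= rho > 1] at distance at most [d / 2]. *)
Lemma fundamental_lemma_pos H t : {within TT, continuous H} ->
  (forall psi, test_function psi -> \int[mu]_(x in TT) (H x * psi x) = 0) ->
  0 < t < 2 * pi -> ~ 0 < H t.
Proof.
move=> cH H0 /andP[t0 t1] Ht.
have pi0 := pi_gt0 R.
have [M M0 HM] : exists2 M, 0 <= M & forall x, TT x -> `|H x| <= M.
  have /compact_bounded[M [_ HM]] := continuous_compact cH
    (segment_compact (a := 0) (b := 2 * pi)).
  exists (`|M| + 1); first by rewrite addr_ge0.
  by move=> x xT; apply: HM; [rewrite ltr_pwDr// ler_norm|exists x].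
pose eta := H t / 2.
have eta0 : 0 < eta by rewrite divr_gt0.
(* The bounds by [t] and [2 * pi - t] keep the window around [t] inside the period and give
   [|x - t| <= 2 * pi - d] for [x] in it, as the estimate far from [t] requires; [d < pi] makes
   [1 + cos d] positive. *)
have [d [d0 dt dt' dpi Hd]] : exists d, [/\ 0 < d, d <= t, d <= 2 * pi - t, d < pi &
    forall x, `|x - t| <= d -> eta <= H x].
  have ct : {for t, continuous H}.
    by apply: (within_continuous_continuous twopi_gt0 cH); rewrite in_itv/= t0.
  have : H t / 2 < H t by rewrite ltr_pdivrMr// ltr_pMr// ltr1n.
  move=> /(cvgr_gt _ ct) /nbhs_ballP[e /= e0 eH].
  pose m := Num.min (Num.min t (2 * pi - t)) (Num.min e 1).
  have m0 : 0 < m by rewrite !lt_min t0 e0 ltr01 subr_gt0 t1.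
  have : m <= m by [].
  rewrite {2}/m !le_min => /andP[/andP[mt mt'] /andP[me m1]].
  have := pi_ge2 R => pi2.
  exists (m / 2); split; rewrite ?divr_gt0//; try lra.
  move=> x xm; apply/ltW/eH; rewrite /ball/= distrC; lra.
have cd : 0 < 1 + cos d.
  have : cos pi < cos d by rewrite ltr_cos// in_itv/=; apply/andP; split; lra.
  rewrite cospi; lra.
pose q x := (1 + cos (x - t)) / (1 + cos d).
have q0 x : 0 <= q x.
  by rewrite divr_ge0// ?(ltW cd)//; have := cos_geN1 (x - t); lra.
pose rho := (1 + cos (d / 2)) / (1 + cos d).
have rho1 : 1 < rho.
  have in0pi z : 0 <= z <= d -> z \in `[0, pi].
    by move=> /andP[z0 zd]; rewrite in_itv/= z0 (le_trans zd)// ltW.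
  rewrite ltr_pdivlMr// mul1r ltrD2l ltr_cos ?in0pi//; first lra.
  - by apply/andP; split; lra.
  - by apply/andP; split; lra.
have q_near x : `|x - t| <= d / 2 -> rho <= q x.
  move=> xd; rewrite ler_pM2r ?invr_gt0// lerD2l -(cos_abs (x - t)).
  by apply: cos_le_cos => //; lra.
have q_far x : TT x -> d < `|x - t| -> q x <= 1.
  rewrite /= in_itv/= => /andP[x0 x1] dx.
  rewrite ler_pdivrMr// mul1r lerD2l -(cos_abs (x - t)); apply: cos_le_cos_far; try lra.
  by rewrite ler_norml; apply/andP; split; lra.
have test_q n : test_function (fun x => q x ^+ n).
  apply/trig_poly_test/trig_poly_pow/trig_mul; last exact: trig_cst.
  by apply: trig_add; [exact: trig_cst|exact: trig_cos].
(* The gain is at least [eta * rho ^+ n] on a window of length [d]; the loss is at most [M] over the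
   period. *)
have [n rhon] := pow_unbounded (M * (2 * pi) / (eta * d)) rho1.
pose I := `[t - d / 2, t + d / 2]%classic.
have mI : measurable (I : set (measurableTypeR R)) by exact: measurable_itv.
(* Three zones: on [I] both factors are large; up to distance [d] the product is still nonnegative;
   beyond, [q <= 1] and [|H| <= M]. *)
have lower x : TT x -> eta * rho ^+ n * \1_I x - M <= H x * q x ^+ n.
  move=> xT; have qn0 : 0 <= q x ^+ n by exact: exprn_ge0.
  rewrite indicE; have [xI|xI] := boolP (x \in I).
    have xd : `|x - t| <= d / 2.
      move: xI => /set_mem; rewrite /I/= in_itv/= => /andP[? ?].
      by rewrite ler_norml; apply/andP; split; lra.
    have Hx : eta <= H x by apply: Hd; lra.
    have : eta * rho ^+ n <= H x * q x ^+ n.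
      apply: ler_pM => //; first exact: ltW.
        by rewrite exprn_ge0//; lra.
      by apply: lerXn2r; rewrite ?nnegrE ?q_near//; lra.
    rewrite mulr1; lra.
  rewrite mulr0 sub0r.
  have [xd|xd] := lerP `|x - t| d.
    have : 0 <= H x * q x ^+ n by rewrite mulr_ge0// (le_trans _ (Hd _ xd))// ltW.
    lra.
  have : `|H x * q x ^+ n| <= M.
    rewrite normrM -[M]mulr1 ler_pM ?HM// ger0_norm//.
    by rewrite exprn_ile1// q_far.
  by rewrite ler_norml => /andP[].
have iI : mu.-integrable TT (EFin \o (\1_I : R -> R)).
  by apply: integrableS (integrable_indic_itv (t - d / 2) (t + d / 2) true false).
have IE : \int[mu]_(x in TT) (\1_I x : R) = d.
  rewrite /Rintegral integral_indic// setIidl.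
    have := lebesgue_measure_itv `[t - d / 2, t + d / 2].
    rewrite /= lte_fin ifT; last lra.
    by rewrite -EFinB => ->/=; lra.
  by move=> x; rewrite /I/= !in_itv/= => /andP[? ?]; apply/andP; split; lra.
have iZ : mu.-integrable TT (EFin \o (fun x => eta * rho ^+ n * \1_I x)).
  exact: integrable_scale.
have iM := integrable_cst M.
have iH : mu.-integrable TT (EFin \o (fun x => H x * q x ^+ n)).
  apply/within_continuous_integrable/within_continuousM => //.
  exact: test_continuous (test_q n).
have mTT : measurable (TT : set (measurableTypeR R)) by exact: measurable_itv.
have iZM : mu.-integrable TT (EFin \o (fun x => eta * rho ^+ n * \1_I x - M)).
  exact: integrable_sub.
have := le_Rintegral mTT iZM iH lower.
rewrite H0// RintegralB// RintegralZl// IE integral_cst_period.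
have : M * (2 * pi) < rho ^+ n * (eta * d) by rewrite -ltr_pdivrMr// mulr_gt0.
by rewrite mulrC -mulrA; lra.
Qed.

Lemma fundamental_lemma H t : {within TT, continuous H} ->
  (forall psi, test_function psi -> \int[mu]_(x in TT) (H x * psi x) = 0) ->
  0 < t < 2 * pi -> H t = 0.
Proof.
move=> cH H0 tT; apply/eqP; rewrite eq_le !leNgt.
apply/andP; split; apply/negP; first exact: fundamental_lemma_pos cH H0 tT.
rewrite -oppr_gt0; apply: (fundamental_lemma_pos (H := fun x => - H x)) tT.
  by move=> x; apply: continuousN; exact: cH.
move=> psi tpsi.
rewrite (@eq_Rintegral _ _ _ mu TT (fun x => -1 * (H x * psi x))); last first.
  by move=> x _; rewrite mulN1r mulNr.
rewrite RintegralZl ?H0 ?mulr0//.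
by apply/within_continuous_integrable/within_continuousM => //; exact: test_continuous.
Qed.

Lemma du_bois_reymond H : {within TT, continuous H} ->
  (forall phi, test_function phi ->
     \int[mu]_(x in TT) (H x * derive1 phi x) = 0) ->
  exists C, forall t, 0 < t < 2 * pi -> H t = C.
Proof.
move=> cH H0; set C := (\int[mu]_(x in TT) H x) / (2 * pi); exists C => t tT.
apply/eqP; rewrite -subr_eq0; apply/eqP.
apply: (fundamental_lemma (H := fun x => H x - C)) tT.
  by move=> x; apply: cvgB; [exact: cH|exact: cvg_cst].
move=> psi tpsi; apply: integral_sub_mean => //.
exact: within_continuous_integrable.
Qed.

Lemma ae_not_endpoints : {ae mu, forall x, x != 0 /\ x != 2 * pi}.
Proof.
exists [set 0; 2 * pi]; split.
- by apply: measurableU; exact: measurable_set1.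
- by apply: countable_lebesgue_measure0; exact: finite_set_countable.
- move=> x /=; have [->|x0] := eqVneq x 0; first by left.
  by have [->|x1] := eqVneq x (2 * pi); [right|move=> []].
Qed.

(* If [f] is orthogonal to derivatives and has mean zero, its primitive from [0]
   is a constant, whose derivative is [f] almost everywhere. *)
Lemma du_bois_reymond_L1 f : mu.-integrable TT (EFin \o f) ->
  (forall phi, test_function phi ->
     \int[mu]_(x in TT) (f x * derive1 phi x) = 0) ->
  exists C, {ae mu, forall x, TT x -> f x = C}.
Proof.
move=> intf f0; set C := (\int[mu]_(x in TT) f x) / (2 * pi); exists C.
pose D x := f x - C.
have intD : mu.-integrable TT (EFin \o D).
  exact: integrable_sub intf (integrable_cst C).
have D0 psi : test_function psi -> \int[mu]_(x in TT) (D x * psi x) = 0.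
  exact: integral_sub_mean.
have meanD : \int[mu]_(x in TT) D x = 0.
  have := D0 _ (test_cst 1).
  by rewrite (@eq_Rintegral _ _ _ mu TT D)// => x _; rewrite mulr1.
pose G x := \int[mu]_(t in `[0, x]) D t.
have [B GB] : exists B, forall t, 0 < t < 2 * pi -> G t = B.
  apply: du_bois_reymond; first exact: primitive_within_continuous.
  move=> phi tphi.
  have := integral_by_parts_L1 (fun x => test_is_derive x tphi)
    (test_continuous (test_derive1 tphi)) intD.
  by rewrite D0// meanD mul0r sub0r => /esym/eqP; rewrite oppr_eq0 => /eqP.
have mTT : measurable (TT : set (measurableTypeR R)) by exact: measurable_itv.
(* Extension by zero turns [G] into an integral from minus infinity, to which Lebesgue
   differentiation applies; the two agree inside the period. *)
pose DT := D \_ TT.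
have intDT y : mu.-integrable `]-oo, y] (EFin \o DT).
  apply: (@integrableS _ _ _ mu setT) => //.
  by rewrite -restrict_EFin; apply/integrable_restrict => //; rewrite setTI.
have := FTC1Ny intDT (integrable_locally mTT intD).
move=> ae1; apply: (filterS2 _ _ ae1 ae_not_endpoints).
  exact: (ae_filter_ringOfSetsType mu).
move=> x [dF F'] [x0 x1].
rewrite /= in_itv/= !le_eqVlt eq_sym (negPf x0) (negPf x1)/= => xT.
apply/eqP; rewrite -subr_eq0 -/(D x); apply/eqP.
have <- : DT x = D x.
  by rewrite /DT patchE mem_set//= in_itv/=; case/andP: xT => *; rewrite !ltW.
have FB y : 0 < y < 2 * pi -> \int[mu]_(t in `]-oo, y]) DT t = B.
  move=> /andP[y0 yT]; rewrite -(GB y) ?y0//.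
  rewrite /DT -Rintegral_mkcondr /G; congr Rintegral.
  apply/seteqP; split => z /=; rewrite !in_itv/=.
    by move=> [zy /andP[-> _]].
  by move=> /andP[-> zy]; rewrite zy (le_trans zy (ltW yT)).
rewrite -F'; apply: (is_derive_unique (x := x)
  (f := fun y => \int[mu]_(t in `]-oo, y]) DT t)).
  by rewrite derive1E; exact/derivableP.
apply: is_derive_near_eq (is_derive_cst B x 1).
have : x \in `]0, 2 * pi[ by rewrite in_itv.
by move=> /near_in_itvoo; apply: filterS => y; rewrite in_itv/= => /FB ->.
Qed.

End FundamentalLemma.

(** * Weak derivatives and regularity *)

Section WeakDerivatives.
Context {R : realType}.
Notation mu := (@lebesgue_measure R).
Notation TT := `[0%R, (2 * pi)%R]%classic.
Implicit Types (f g h K phi psi : R -> R) (x y : R).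

Lemma test_derive1n n phi : test_function phi -> test_function (derive1n n phi).
Proof.
move=> tphi; elim: n => [|n ih]; first exact: tphi.
by rewrite derive1nS; exact: test_derive1 ih.
Qed.

Lemma measurable_mul_test f phi :
  measurableR f ->
  test_function phi ->
  measurableR (fun x => f x * phi x).
Proof.
move=> mf /test_continuous cphi; apply: measurable_funM => //.
exact: continuous_measurable_fun.
Qed.

Lemma weak_derivn_period n f g : weak_derivn n f g ->
  [/\ mu.-integrable TT (EFin \o f), mu.-integrable TT (EFin \o g) &
   forall phi, test_function phi -> \int[mu]_(x in TT) (f x * derive1n n phi x) =
     (- 1) ^+ n * \int[mu]_(x in TT) (g x * phi x)].
Proof.
move=> [[_ Lf] [_ Lg] fg]; split; [exact: Lfun1_integrable_period..|].
move=> phi tphi; have := fg phi tphi; rewrite !Rintegral_muT//.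
  exact: measurable_mul_test (Lfun_measurable Lg) tphi.
exact: measurable_mul_test (Lfun_measurable Lf) (test_derive1n n tphi).
Qed.

Lemma ae_period (P : R -> Prop) : {ae muT R, forall x, P x} ->
  {ae mu, forall x, TT x -> P x}.
Proof.
move=> [N [mN N0 PN]]; exists (N `&` TT); split => //.
  by apply: measurableI => //; exact: measurable_itv.
by move=> x /= /not_implyP[xT Px]; split => //; exact: PN.
Qed.

Lemma ae_eq_integral_mul f g phi : mu.-integrable TT (EFin \o f) ->
  mu.-integrable TT (EFin \o g) -> {ae mu, forall x, TT x -> f x = g x} ->
  continuous phi ->
  \int[mu]_(x in TT) (f x * phi x) = \int[mu]_(x in TT) (g x * phi x).
Proof.
move=> intf intg fg cphi; congr fine; apply: ae_eq_integral => //.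
- exact: measurable_int (integrable_mul_continuous intf cphi).
- exact: measurable_int (integrable_mul_continuous intg cphi).
- by move: fg; apply: filterS; [exact: (ae_filter_ringOfSetsType mu)|];
    move=> x fgx xT; rewrite fgx.
Qed.

Lemma periodic_primitive f : continuous f -> periodic f (2 * pi) ->
  \int[mu]_(x in TT) f x = 0 ->
  exists F, [/\ forall x, is_derive x 1 F (f x), periodic F (2 * pi) &
    \int[mu]_(x in TT) F x = 0].
Proof.
move=> cf pf f0; have [F dF] := antiderivative cf.
have pF := periodic_antiderivative cf pf f0 dF.
have cF : continuous F by move=> x; exact: is_derive_continuous (dF x).
exists (fun x => F x - (\int[mu]_(y in TT) F y) / (2 * pi)); split.
- move=> x; rewrite -[f x]subr0.
  by apply: is_derive_sub (dF x) (is_derive_cst _ _ _).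
- by move=> x; rewrite pF.
- rewrite RintegralB//; last exact: integrable_cst.
    by rewrite integral_cst_period divfK ?subrr// twopi_neq0.
  exact: continuous_integrable_itv.
Qed.

(** [psi] itself has a periodic primitive only if its mean is zero, but removing the mean does not
    change [derive1 psi]; doing this twice raises the order from one to three. *)
Lemma test_third_primitive psi : test_function psi ->
  exists2 phi, test_function phi & derive1n 3 phi = derive1 psi.
Proof.
have prim psi' : test_function psi' ->
    exists2 phi, test_function phi & derive1n 2 phi = derive1 psi'.
  move=> tpsi; have [phi tphi phiE] := test_sub_mean_derive tpsi.
  exists phi; first exact: tphi.
  rewrite derive1Sn derive1n1 phiE; apply/funext => x.
  rewrite !derive1E; set c := _ / _.
  have [_ ->] := is_derive_sub (test_is_derive x tpsi) (is_derive_cst c x 1).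
  by rewrite subr0 derive1E.
move=> /prim [chi tchi <-]; have [phi tphi phiE] := prim _ tchi.
exists phi; first exact: tphi.
by rewrite derive1nS phiE [RHS]derive1nS derive1n1.
Qed.

Lemma periodic_continuous_cst f C : continuous f -> periodic f (2 * pi) ->
  (forall x, 0 < x < 2 * pi -> f x = C) -> forall x, f x = C.
Proof.
move=> cf pf fC x; have [y] := periodic_translate 0 x twopi_gt0 pf.
rewrite add0r => /andP[y0 yT] ->; move: y0; rewrite le_eqVlt => /predU1P[<-|y0].
  have f0 : f z @[z --> 0^'+] --> f 0 by apply: cvg_at_right_filter; exact: cf.
  apply: (cvg_unique _ f0) => //.
  apply: (@cvg_trans _ ((fun=> C) z @[z --> 0^'+])); last exact: cvg_cst.
  apply: near_eq_cvg; near=> z; rewrite fC//; apply/andP; split.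
    by near: z; exact: nbhs_right_gt.
  by near: z; exact: nbhs_right_lt twopi_gt0.
by rewrite fC// y0.
Unshelve. all: by end_near. Qed.

(* [W], [W1], [W2] are successive primitives of mean zero, of which [W] is the
   expected value of [h'']; [h - W2] is orthogonal to third derivatives. *)
Lemma weak_third_order_regularity h K :
  continuous h -> periodic h (2 * pi) -> continuous K -> periodic K (2 * pi) ->
  (forall phi, test_function phi ->
     \int[mu]_(x in TT) (h x * derive1n 1 phi x) +
     \int[mu]_(x in TT) (h x * derive1n 3 phi x) =
     - \int[mu]_(x in TT) (K x * phi x)) ->
  exists v v1 : R -> R, [/\ forall x, is_derive x 1 h (v x),
    forall x, is_derive x 1 v (v1 x) &
    forall x, is_derive x 1 v1 (K x - v x)].
Proof.
move=> ch ph cK pK hK.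
(* Obtained by testing with [1]; without mean zero [K] would have no periodic primitive. *)
have K0 : \int[mu]_(x in TT) K x = 0.
  have d0 n : derive1n n.+1 (fun=> 1 : R) = fun=> 0.
    elim: n => [|n ih]; last rewrite derive1nS ih.
      by rewrite derive1n1; apply/funext => x; rewrite derive1_cst.
    by apply/funext => x; rewrite derive1_cst.
  have := hK _ (test_cst 1); rewrite !d0.
  under eq_Rintegral do rewrite mulr0.
  rewrite integral_cst_period mul0r addr0.
  under eq_Rintegral do rewrite mulr1.
  by move=> /esym/eqP; rewrite oppr_eq0 => /eqP.
have [K1 [dK1 pK1 mK1]] := periodic_primitive cK pK K0.
have cK1 : continuous K1 by move=> x; exact: is_derive_continuous (dK1 x).
have ih : mu.-integrable TT (EFin \o h) by exact: continuous_integrable_itv.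
have iK1 : mu.-integrable TT (EFin \o K1) by exact: continuous_integrable_itv.
pose C := (\int[mu]_(x in TT) h x) / (2 * pi).
(* Integrating [h' + h''' = K] once gives [h'' = K1 - h] up to a constant, which [C] adjusts so that
   [W] again has mean zero. *)
pose W x := K1 x - (h x - C).
have cW : continuous W.
  by move=> x; apply: cvgB; [exact: cK1|apply: cvgB; [exact: ch|exact: cvg_cst]].
have pW : periodic W (2 * pi) by move=> x; rewrite /W pK1 ph.
have mW : \int[mu]_(x in TT) W x = 0.
  have ihC : mu.-integrable TT (EFin \o (fun x => h x - C)).
    exact: integrable_sub ih (integrable_cst C).
  rewrite RintegralB// RintegralB//; last exact: integrable_cst.
  by rewrite mK1 integral_cst_period divfK ?subrr// twopi_neq0.
have [W1 [dW1 pW1 mW1]] := periodic_primitive cW pW mW.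
have cW1 : continuous W1 by move=> x; exact: is_derive_continuous (dW1 x).
have [W2 [dW2 pW2 mW2]] := periodic_primitive cW1 pW1 mW1.
have cW2 : continuous W2 by move=> x; exact: is_derive_continuous (dW2 x).
have by_parts f f1 phi : (forall x, is_derive x 1 f (f1 x)) -> continuous f1 ->
    periodic f (2 * pi) -> test_function phi ->
    \int[mu]_(x in TT) (f x * derive1 phi x) = - \int[mu]_(x in TT) (f1 x * phi x).
  move=> df cf1 pf tphi; apply: integral_by_parts_periodic => //.
  - by move=> x; exact: test_is_derive.
  - exact: test_continuous (test_derive1 tphi).
  - exact: tphi.1.
have iM f phi : continuous f -> test_function phi ->
    mu.-integrable TT (EFin \o (fun x => f x * phi x)).
  move=> cf tphi; apply: integrable_mul_continuous (test_continuous tphi).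
  exact: continuous_integrable_itv.
have [C2 hC2] : exists C2, forall x, h x = W2 x + C2.
  have cV : continuous (fun x => h x - W2 x).
    by move=> x; apply: cvgB; [exact: ch|exact: cW2].
  have [|C2 hC2] := du_bois_reymond (continuous_within_subset (A := TT) cV).
    (* Du Bois-Reymond tests with first derivatives, the equation involves third ones; here they
       coincide. *)
    move=> psi /test_third_primitive [phi tphi <-].
    have t1 := test_derive1n 1 tphi; have t2 := test_derive1n 2 tphi.
    have t3 := test_derive1n 3 tphi.
    rewrite (@eq_Rintegral _ _ _ mu TT
      (fun x => h x * derive1n 3 phi x - W2 x * derive1n 3 phi x)); last first.
      by move=> x _; rewrite mulrBl.
    rewrite RintegralB//; [|exact: iM..].
    have -> : \int[mu]_(x in TT) (W2 x * derive1n 3 phi x) =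
        \int[mu]_(x in TT) (W x * derive1n 1 phi x).
      rewrite (by_parts _ _ _ dW2 cW1 pW2 t2) (by_parts _ _ _ dW1 cW pW1 t1).
      by rewrite opprK.
    have mphi : \int[mu]_(x in TT) (derive1n 1 phi x) = 0.
      rewrite (integral_antiderivative (test_continuous t1)
        (fun x => test_is_derive x tphi)).
      by rewrite -[2 * pi]add0r tphi.1 subrr.
    rewrite (@eq_Rintegral _ _ _ mu TT (fun x => K1 x * derive1n 1 phi x -
      (h x * derive1n 1 phi x - C * derive1n 1 phi x))
      (fun x => W x * derive1n 1 phi x)); last by move=> x _; rewrite /W; ring.
    have iC : mu.-integrable TT (EFin \o (fun x => C * derive1n 1 phi x)).
      by apply: integrable_scale; exact: continuous_integrable_itv (test_continuous t1).
    have ihC : mu.-integrable TT (EFin \o (fun x => h x * derive1n 1 phi x -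
        C * derive1n 1 phi x)).
      exact: integrable_sub (iM _ _ ch t1) iC.
    rewrite RintegralB//; last exact: iM.
    rewrite RintegralB//; last exact: iM.
    rewrite RintegralZl//; last exact: continuous_integrable_itv (test_continuous t1).
    rewrite mphi (by_parts _ _ _ dK1 cK pK1 tphi).
    have lin (a b k : R) : a + b = - k -> b - (- k - (a - C * 0)) = 0.
      by move=> e; lra.
    exact: (lin _ _ _ (hK phi tphi)).
  exists C2 => x; apply/eqP; rewrite addrC -subr_eq; apply/eqP.
  by apply: periodic_continuous_cst hC2 x => // x; rewrite ph pW2.
have dh x : is_derive x 1 h (W1 x).
  have -> : h = fun y => W2 y + C2 by apply/funext.
  by rewrite -[W1 x]addr0; apply: is_derive_add (dW2 x) (is_derive_cst _ _ _).
(* Bootstrap: [W] contains [h], now known to have derivative [W1], so [W] is differentiable too. *)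
exists W1, W; split => // x.
by rewrite -[W1 x]subr0; apply: is_derive_sub (dK1 x) _.
Qed.

End WeakDerivatives.

(** * Constancy of steady states and travelling waves *)

Section TravellingWaves.
Context {R : realType}.
Notation mu := (@lebesgue_measure R).
Notation TT := `[0%R, (2 * pi)%R]%classic.
Implicit Types (h f g phi : R -> R) (c k x : R).

(** The pair [(c, k)] treats all the equations of (a) and (c) at once. At [(0, 0)] a vanishing flux
    would only say [A = 0] and leave [h] free, which is where the sinusoids of (b) live. *)
Lemma flux_constant c k h (h1 h3 : R -> R) : (c, k) != (0, 0) ->
  continuous h -> (forall x, 0 < h x) ->
  weak_derivn 1 h h1 -> weak_derivn 3 h h3 ->
  mu.-integrable TT (EFin \o (fun x => h x ^+ 3 * (h1 x + h3 x))) ->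
  (forall phi, test_function phi ->
    \int[mu]_(x in TT) ((h x ^+ 3 * (h1 x + h3 x) - (c * h x - k * (h x ^+ 2 / 2)))
                        * derive1 phi x) = 0) ->
  exists C, forall x, h x = C.
Proof.
move=> ck ch h0 wh1 wh3 iF eqF.
have ph : periodic h (2 * pi) by case: wh1 => [[]].
have [ih ih1 hh1] := weak_derivn_period wh1.
have [_ ih3 hh3] := weak_derivn_period wh3.
have cpow n : continuous (fun x => h x ^+ n).
  elim: n => [|n ih']; first by move=> x; exact: cvg_cst.
  have -> : (fun x => h x ^+ n.+1) = (fun x => h x * h x ^+ n).
    by apply/funext => x; rewrite exprS.
  by move=> x; apply: cvgM; [exact: ch|exact: ih'].
have cflux : continuous (fun x => c * h x - k * (h x ^+ 2 / 2)).
  move=> x; apply: cvgB; first by apply: cvgM; [exact: cvg_cst|exact: ch].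
  apply: cvgM; first exact: cvg_cst.
  by apply: cvgM; [exact: cpow|exact: cvg_cst].
have [A fA] := du_bois_reymond_L1
  (integrable_sub iF (continuous_integrable_itv 0 (2 * pi) cflux)) eqF.
pose K x := (A + c * h x - k * (h x ^+ 2 / 2)) / h x ^+ 3.
have h3n0 x : h x ^+ 3 != 0 by rewrite expf_neq0// gt_eqF.
have cK : continuous K.
  have -> : K = fun x => (A + (c * h x - k * (h x ^+ 2 / 2))) / h x ^+ 3.
    by apply/funext => x; rewrite /K addrA.
  move=> x; apply: cvgM; last by apply: cvgV => //; exact: cpow.
  by apply: cvgD; [exact: cvg_cst|exact: cflux].
have pK : periodic K (2 * pi) by move=> x; rewrite /K ph.
have ih13 : mu.-integrable TT (EFin \o (fun x => h1 x + h3 x)).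
  exact: (integrableD _ ih1 ih3).
have hK : {ae mu, forall x, TT x -> h1 x + h3 x = K x}.
  apply: filterS fA; first exact: (ae_filter_ringOfSetsType mu).
  move=> x fx xT; apply: (mulfI (h3n0 x)).
  rewrite /K mulrCA divff// mulr1 -(fx xT); ring.
have [|v [v1 [dh dv dv1]]] := weak_third_order_regularity ch ph cK pK.
  move=> phi tphi; have cphi := test_continuous tphi.
  (* Orders one and three carry the same sign, so only the sum [h1 + h3] appears, and only this sum
     is known to agree with the continuous [K]. *)
  rewrite hh1// hh3// -(ae_eq_integral_mul ih13 _ hK cphi); last first.
    exact: continuous_integrable_itv.
  rewrite (@eq_Rintegral _ _ _ mu TT (fun x => h1 x * phi x + h3 x * phi x)
    (fun x => (h1 x + h3 x) * phi x)); last by move=> x _; rewrite mulrDl.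
  rewrite RintegralD//; [|exact: integrable_mul_continuous..].
  by rewrite expr1 exprS expr2 mulN1r; ring.
exact: periodic_solution_constant h0 dh dv dv1 ck ph.
Qed.

(** Passes from an identity between derivatives almost everywhere to orthogonality against
    derivatives, the form in which du Bois-Reymond's lemma integrates it. *)
Lemma weak_derivn1_ae0 a b f g j (f1 g1 j1 : R -> R) :
  weak_derivn 1 f f1 -> weak_derivn 1 g g1 -> weak_derivn 1 j j1 ->
  {ae muT R, forall x, f1 x - (a * g1 x - b * j1 x) = 0} ->
  forall phi, test_function phi ->
    \int[mu]_(x in TT) ((f x - (a * g x - b * j x)) * derive1 phi x) = 0.
Proof.
move=> /weak_derivn_period[iff if1 hf] /weak_derivn_period[ig ig1 hg].
move=> /weak_derivn_period[ij ij1 hj] /ae_period ae0 phi tphi.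
have expand (u1 u2 u3 psi : R -> R) : mu.-integrable TT (EFin \o u1) ->
    mu.-integrable TT (EFin \o u2) -> mu.-integrable TT (EFin \o u3) ->
    continuous psi ->
    \int[mu]_(x in TT) ((u1 x - (a * u2 x - b * u3 x)) * psi x) =
    \int[mu]_(x in TT) (u1 x * psi x) - (a * \int[mu]_(x in TT) (u2 x * psi x) -
      b * \int[mu]_(x in TT) (u3 x * psi x)).
  move=> i1 i2 i3 cpsi.
  have m1 := integrable_mul_continuous i1 cpsi.
  have m2 := integrable_mul_continuous i2 cpsi.
  have m3 := integrable_mul_continuous i3 cpsi.
  have z2 := integrable_scale a m2; have z3 := integrable_scale b m3.
  rewrite (@eq_Rintegral _ _ _ mu TT
    (fun x => u1 x * psi x - (a * (u2 x * psi x) - b * (u3 x * psi x)))); last first.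
    by move=> x _; ring.
  have m23 : mu.-integrable TT (EFin \o
      (fun x => a * (u2 x * psi x) - b * (u3 x * psi x))).
    exact: integrable_sub.
  by rewrite !RintegralB// !RintegralZl.
have t1 := test_derive1 tphi.
rewrite expand//; last exact: test_continuous.
move: (hf _ tphi) (hg _ tphi) (hj _ tphi); rewrite !derive1n1 => -> -> ->.
have cphi := test_continuous tphi.
have icomb : mu.-integrable TT (EFin \o (fun x => f1 x - (a * g1 x - b * j1 x))).
  have i23 : mu.-integrable TT (EFin \o (fun x => a * g1 x - b * j1 x)).
    exact: integrable_sub (integrable_scale a ig1) (integrable_scale b ij1).
  exact: integrable_sub.
have := ae_eq_integral_mul icomb (integrable_cst 0) ae0 cphi.
rewrite expand//.
under [X in _ = X]eq_Rintegral do rewrite mul0r.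
rewrite integral_cst_period mul0r expr1 => e; lra.
Qed.

Lemma ae_muT_imply (P Q : R -> Prop) : (forall x, P x -> Q x) ->
  {ae muT R, forall x, P x} -> {ae muT R, forall x, Q x}.
Proof.
by move=> PQ; apply: filterS => //; exact: (ae_filter_ringOfSetsType (muT R)).
Qed.

Lemma gravity_wave_constant c h : positive_solution (gravity_wave_eq c) h ->
  exists C, forall x, h x = C.
Proof.
move=> [[ch _] h0 [h1 [k [d [wh wk [h1' [h3 [wh1 wh3 wd]]] eq0]]]]].
have [iF _ _] := weak_derivn_period wd.
apply: (flux_constant (c := c) (k := 1)) ch h0 wh1 wh3 iF _.
  by rewrite xpair_eqE oner_eq0 andbF.
apply: (weak_derivn1_ae0 wd wh wk).
by apply: ae_muT_imply eq0 => x e; rewrite -[RHS]e; ring.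
Qed.

Lemma gravity_steady_constant h : positive_solution (@gravity_steady_eq R) h ->
  exists C, forall x, h x = C.
Proof.
move=> [hT h0 [k [d [wk cd eq0]]]]; have [h1 [h3 [wh1 _ _]]] := cd.
apply: (gravity_wave_constant (c := 0)); split => //; exists h1, k, d; split => //.
by apply: ae_muT_imply eq0 => x e; rewrite oppr0 mul0r add0r.
Qed.

Lemma capillary_wave_constant c h : c != 0 ->
  positive_solution (capillary_wave_eq c) h -> exists C, forall x, h x = C.
Proof.
move=> c0 [[ch _] h0 [h1 [d [wh [h1' [h3 [wh1 wh3 wd]]] eq0]]]].
have [iF _ _] := weak_derivn_period wd.
apply: (flux_constant (c := c) (k := 0)) ch h0 wh1 wh3 iF _.
  by rewrite xpair_eqE (negPf c0).
(* The gravity term has coefficient [0]; [h] itself fills its place. *)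
move=> phi tphi; rewrite -[RHS](@weak_derivn1_ae0 c 0 _ _ _ _ _ _ wd wh wh _ phi tphi).
  by apply: eq_Rintegral => x _; rewrite !mul0r.
by apply: ae_muT_imply eq0 => x e; rewrite -[RHS]e; ring.
Qed.

Lemma integral_muT_cst C : \int[muT R]_x C = 2 * pi * C.
Proof.
rewrite Rintegral_muT; last exact: measurable_cst.
by rewrite integral_cst_period mulrC.
Qed.

Lemma constant_eq_mean h hs : (exists C, forall x, h x = C) ->
  \int[muT R]_x h x = 2 * pi * hs -> forall x, h x = hs.
Proof.
move=> [C hC]; have -> : h = fun=> C by exact/funext.
by rewrite integral_muT_cst => /(mulfI twopi_neq0).
Qed.

End TravellingWaves.

(** * The sinusoidal capillary solutions *)

Section CapillarySolutions.
Context {R : realType}.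
Notation mu := (@lebesgue_measure R).
Notation TT := `[0%R, (2 * pi)%R]%classic.
Implicit Types (f g h phi : R -> R) (x z c theta : R).

Lemma Lfun_continuous_periodic f (p : R) : 1 <= p -> continuous f ->
  periodic f (2 * pi) -> f \in Lfun (muT R) p%:E.
Proof.
move=> p1 cf pf.
have [M M0 fM] := continuous_bounded_period cf.
have {}fM x : `|f x| <= M.
  have [y /andP[y0 yT] ->] := periodic_translate 0 x twopi_gt0 pf.
  by apply: fM; rewrite /= in_itv/= y0 ltW// -[2 * pi]add0r.
have p0 : 0 < p by rewrite (lt_le_trans ltr01).
have mf : measurableR f.
  exact: continuous_measurable_fun.
rewrite inE; apply/andP; split; rewrite inE//=.
rewrite /finite_norm unlock /Lnorm poweR_lty//.
have mp : measurableR (fun x => `|f x| `^ p).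
  apply: (@measurableT_comp _ _ _ _ _ _ (@powR R ^~ p)) => //.
  exact: measurableT_comp.
have : (muT R).-integrable setT (EFin \o (fun x => `|f x| `^ p)).
  apply: measurable_bounded_integrable => //.
    by rewrite ltey_eq fin_num_measure.
  exists (M `^ p); split; first exact: num_real.
  move=> y yM x _; rewrite /= ger0_norm ?powR_ge0// ltW// (le_lt_trans _ yM)//.
  by rewrite ge0_ler_powR// ?nnegrE// ltW.
by move=> intp; exact: (integrable_lty _ intp).
Qed.

Lemma weak_derivn_test n f : test_function f -> weak_derivn n f (derive1n n f).
Proof.
move=> tf.
have L1 m : periodic (derive1n m f) (2 * pi) /\
    derive1n m f \in Lfun (muT R) 1%E.
  have tm := test_derive1n m tf; split; first exact: tm.1.
  by apply: Lfun_continuous_periodic => //; [exact: test_continuous|exact: tm.1].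
have m_test g phi : test_function g -> test_function phi ->
    measurableR (fun x => g x * phi x).
  move=> tg tphi; apply: measurable_mul_test => //.
  by apply: continuous_measurable_fun; exact: test_continuous.
split; [exact: (L1 0)|exact: L1|].
elim: n => [|n ih] phi tphi; first by rewrite expr0 mul1r.
have tn := test_derive1n n tf; have tn1 := test_derive1n n.+1 tf.
rewrite derive1Sn (ih _ (test_derive1 tphi)) exprS -mulrA mulN1r -mulrN.
congr (_ * _); rewrite !Rintegral_muT; [|exact: m_test..|]; last first.
  exact: m_test (test_derive1 tphi).
apply: integral_by_parts_periodic.
- by move=> x; rewrite derive1nS; exact: test_is_derive.
- exact: test_continuous.
- exact: tn.1.
- by move=> x; exact: test_is_derive.
- exact: test_continuous (test_derive1 tphi).
- exact: tphi.1.
Qed.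

Lemma HT_test k f : test_function f -> HT k f.
Proof.
move=> tf; split=> [|n _]; first exact: test_continuous.
have tn := test_derive1n n tf.
exists (derive1n n f); first exact: weak_derivn_test.
apply: Lfun_continuous_periodic; [by rewrite ler1n|exact: test_continuous|].
exact: tn.1.
Qed.

Lemma derive1_sin_shift c theta :
  derive1 (fun x => c * sin (x - theta)) = fun x => c * cos (x - theta).
Proof.
apply/funext => x; rewrite derive1E; apply: derive_val.
apply: is_derive_scale.
exact: (@is_derive_shiftl _ sin x _ (- theta) (is_derive_sin _)).
Qed.

Lemma derive1_cos_shift c theta :
  derive1 (fun x => c * cos (x - theta)) = fun x => - c * sin (x - theta).
Proof.
apply/funext => x; rewrite derive1E; apply: derive_val.
rewrite mulNr -mulrN; apply: is_derive_scale.
exact: (@is_derive_shiftl _ cos x _ (- theta) (is_derive_cos _)).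
Qed.

Variables c1 c2 theta0 : R.
Let h x := c1 + c2 * sin (x - theta0).

Let derive1_h : derive1 h = fun x => c2 * cos (x - theta0).
Proof.
apply/funext => x; rewrite derive1E; apply: derive_val.
rewrite -[c2 * cos _]add0r; apply: is_derive_add (is_derive_cst c1 x 1) _.
apply: is_derive_scale.
exact: (@is_derive_shiftl _ sin x _ (- theta0) (is_derive_sin _)).
Qed.

Let test_h : test_function h.
Proof.
by apply/trig_poly_test/trig_add/trig_mul/trig_sin; exact: trig_cst.
Qed.

(** [h] is smooth, so its weak derivatives are classical, and [h' + h''' = 0] makes the flux vanish
    identically. *)
Lemma sinusoid_positive_solution : `|c2| < c1 ->
  positive_solution (@capillary_steady_eq R) h.
Proof.
move=> c21; split; first exact: HT_test.
  move=> x; have : `|c2 * sin (x - theta0)| <= `|c2|.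
    by rewrite normrM ler_piMr// ler_norml sin_geN1 sin_le1.
  by rewrite ler_norml => /andP[+ _]; rewrite /h; lra.
exists (fun=> 0); last by apply: aeW.
exists (derive1n 1 h), (derive1n 3 h); split; [exact: weak_derivn_test..|].
have -> : (fun x => h x ^+ 3 * (derive1n 1 h x + derive1n 3 h x)) = fun=> 0.
  apply/funext => x; rewrite [derive1n 3 h]derive1nS [derive1n 2 h]derive1nS.
  by rewrite !derive1n1 derive1_h derive1_cos_shift derive1_sin_shift; ring.
have -> : (fun=> 0) = derive1n 1 (fun=> 0 : R).
  by apply/funext => x; rewrite derive1n1 derive1_cst.
rewrite {1}(_ : derive1n 1 _ = fun=> 0).
  exact: weak_derivn_test (test_cst 0).
by apply/funext => x; rewrite derive1n1 derive1_cst.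
Qed.

Lemma sinusoid_integral : \int[muT R]_x h x = 2 * pi * c1.
Proof.
rewrite Rintegral_muT; last first.
  by apply: continuous_measurable_fun; exact: test_continuous.
have dF x : is_derive x 1 (fun y => c1 * y - c2 * cos (y - theta0)) (h x).
  have dc : is_derive x 1 (fun y => cos (y - theta0)) (- sin (x - theta0)).
    exact: (@is_derive_shiftl _ cos x _ (- theta0) (is_derive_cos _)).
  refine (is_derive_eq (is_derive_sub (is_derive_scale c1 (is_derive_id x 1))
    (is_derive_scale c2 dc)) _).
  by rewrite /h; ring.
rewrite (integral_antiderivative (test_continuous test_h) dF).
have -> : cos (2 * pi - theta0) = cos (0 - theta0).
  by rewrite -[RHS]cosD2pi mulr2n; congr cos; ring.
by ring.
Qed.

Lemma cos_eq1_small z : `|z| < 2 * pi -> cos z = 1 -> z = 0.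
Proof.
rewrite -cos_abs => zT cz; have pi0 := pi_gt0 R.
have [zpi|piz] := lerP `|z| pi.
  apply/normr0_eq0/(@cos_inj R); rewrite ?in_itv/= ?lexx ?normr_ge0 ?(ltW pi0)//.
  by rewrite cos0.
have : 2 * pi - `|z| = 0.
  apply: (@cos_inj R); rewrite ?in_itv/= ?lexx ?(ltW pi0)//.
    by apply/andP; split; lra.
  rewrite cos0 -[RHS]cz -[LHS]cosN opprB -[LHS]cosD2pi mulr2n.
  by congr cos; ring.
lra.
Qed.

End CapillarySolutions.

(** * Independence of amplitude and phase *)

Section SinusoidParameters.
Context {R : realType}.
Implicit Types c theta x : R.

(** Evaluation at [theta + pi / 2], where the left sine equals [1]. *)
Lemma sinusoid_amplitude_le (c c' theta theta' hs : R) : 0 < c' ->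
  (forall x, hs + c * sin (x - theta) = hs + c' * sin (x - theta')) ->
  c <= c'.
Proof.
move=> c0 /(_ (theta + pi / 2)) /addrI.
rewrite addrAC subrr add0r sin_pihalf mulr1 => ->.
by rewrite ler_piMr ?sin_le1// ltW.
Qed.

(** With equal amplitudes, the same point gives [cos (theta - theta') = 1], and the phases differ by
    less than a period. Positive amplitudes exclude the coincidence of [(c, theta)] with
    [(- c, theta + pi)]. *)
Lemma sinusoid_parameters_inj (c c' theta theta' hs : R) : 0 < c -> 0 < c' ->
  0 <= theta < 2 * pi -> 0 <= theta' < 2 * pi ->
  (forall x, hs + c * sin (x - theta) = hs + c' * sin (x - theta')) ->
  c = c' /\ theta = theta'.
Proof.
move=> c0 c0' /andP[t0 t1] /andP[t0' t1'] eqh.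
have cc : c = c'.
  apply/eqP; rewrite eq_le (sinusoid_amplitude_le c0' eqh)/=.
  exact: (sinusoid_amplitude_le c0 (fun x => esym (eqh x))).
split=> //; have := eqh (theta + pi / 2); rewrite -cc => /addrI/mulfI.
rewrite gt_eqF// => /(_ isT).
rewrite addrAC subrr add0r sin_pihalf addrAC sinDpihalf => /esym ct.
apply/eqP; rewrite -subr_eq0; apply/eqP; apply: cos_eq1_small ct.
by rewrite ltr_norml; apply/andP; split; lra.
Qed.

End SinusoidParameters.

Theorem proposition4p3 (R : realType) :
  (* (a) *)
  (forall L : R, 0 < L -> exists2 eps : R, 0 < eps &
     forall (hs : R) (h : R -> R), 0 < hs -> L^-1 <= hs <= L ->
       positive_solution (@gravity_steady_eq R) h ->
       (normT_oo (fun x => h x - hs)%R <= eps%:E)%E ->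
       \int[muT R]_x h x = 2 * pi * hs ->
       forall x, h x = hs)
  /\
  (* (b) *)
  (forall hs : R, 0 < hs ->
     (forall c1 c2 theta0 : R, 0 < c1 -> `|c2| < c1 ->
        let h := fun x : R => c1 + c2 * sin (x - theta0) in
        positive_solution (@capillary_steady_eq R) h /\
        (\int[muT R]_x h x = 2 * pi * hs <-> c1 = hs))
     /\
     (* c2 and theta0 are two independent parameters *)
     (forall c2 c2' theta0 theta0' : R,
        0 < c2 < hs -> 0 < c2' < hs ->
        0 <= theta0 < 2 * pi -> 0 <= theta0' < 2 * pi ->
        (forall x : R, hs + c2 * sin (x - theta0) =
                       hs + c2' * sin (x - theta0')) ->
        c2 = c2' /\ theta0 = theta0'))
  /\
  (* (c); for c = 0 the second equation is that of (b), whose nonconstant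
     solutions c1 + c2 sin (x - theta0) lie arbitrarily close to c1 *)
  (forall L : R, 0 < L -> exists2 eps : R, 0 < eps &
     forall (c hs : R) (h : R -> R), - L <= c <= L -> 0 < hs ->
       L^-1 <= hs <= L ->
       positive_solution (gravity_wave_eq c) h \/
       (c != 0 /\ positive_solution (capillary_wave_eq c) h) ->
       (normT_oo (fun x => h x - hs)%R <= eps%:E)%E ->
       \int[muT R]_x h x = 2 * pi * hs ->
       forall x, h x = hs).
Proof.
split; [|split].
- move=> L L0; exists 1 => // hs h _ _ hsol _.
  exact: constant_eq_mean (gravity_steady_constant hsol).
- move=> hs hs0; split; last first.
    move=> c2 c2' theta0 theta0' /andP[c0 _] /andP[c0' _].
    exact: sinusoid_parameters_inj.
  move=> c1 c2 theta0 c10 c21 h; split; first exact: sinusoid_positive_solution.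
  rewrite sinusoid_integral; split=> [|->//].
  exact: (mulfI twopi_neq0).
- move=> L L0; exists 1 => // c hs h _ _ _ hsol _.
  apply: constant_eq_mean; case: hsol => [|[c0]].
    exact: gravity_wave_constant.
  exact: capillary_wave_constant.
Qed.
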